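(* Let $m\in\mathbb{N}$ with $m\geq 3$. Further, let $n\in\mathbb{N}\setminus\{1,2\}$ and let $\Lambda_n(t,W)\in\mathcal{M}(\mathcal{O}_n)$ be a cyclotomic model set. The following statements are equivalent: (i) There is an affinely regular $m$-gon in $\Lambda_n(t,W)$. (ii) $\mathbb{k}_m\subset\mathbb{k}_n$. (iii) $m\in\{3,4,6\}$, or $\mathbb{K}_m\subset\mathbb{K}_n$. (iv) $m\in\{3,4,6\}$, or $m\mid n$, or $m=2d$ with $d$ an odd divisor of $n$. (v) $m\in\{3,4,6\}$, or $\mathcal{O}_m\subset\mathcal{O}_n$. (vi) $o_m\subset o_n$.
   Context: Identify $\mathbb{C}$ with $\mathbb{R}^2$. For $n\in\mathbb{N}$ let $\zeta_n=e^{2\pi i/n}$, $\mathbb{K}_n=\mathbb{Q}(\zeta_n)$, $\mathbb{k}_n=\mathbb{Q}(\zeta_n+\bar\zeta_n)$, $\mathcal{O}_n=\mathbb{Z}[\zeta_n]$, $o_n=\mathbb{Z}[\zeta_n+\bar\zeta_n]$, and let $\phi$ be Euler's totient function. The symbol $\subset$ includes equality. A regular polygon is always planar, non-degenerate and convex. An affinely regular polygon is the image of a regular polygon under a non-singular affine transformation $\mathbb{R}^2\to\mathbb{R}^2$, $z\mapsto Az+t$ with $\det A\neq0$. A polygon in a set $S\subset\mathbb{R}^2$ is a convex polygon all of whose vertices lie in $S$. Cyclotomic model sets. For $n\in\mathbb{N}\setminus\{1,2\}$, choose exactly one automorphism from each pair of complex conjugate automorphisms in $\mathrm{Gal}(\mathbb{K}_n/\mathbb{Q})$,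 obtaining $\sigma_1=\mathrm{id},\sigma_2,\dots,\sigma_{\phi(n)/2}$. The associated star map $\star:\mathcal{O}_n\to(\mathbb{R}^2)^{\phi(n)/2-1}$ is $z\mapsto(\sigma_2(z),\dots,\sigma_{\phi(n)/2}(z))$; if $n\in\{3,4,6\}$, $(\mathbb{R}^2)^{0}$ is the trivial group $\{0\}$ and the star map is $0$. A window is a set $W\subset(\mathbb{R}^2)^{\phi(n)/2-1}$ with $\varnothing\neq W^\circ\subset W\subset\overline{W^\circ}$ and $\overline{W^\circ}$ compact. For a window $W$ and $t\in\mathbb{R}^2$ set $\Lambda_n(t,W)=t+\{z\in\mathcal{O}_n : z^\star\in W\}$. $\mathcal{M}(\mathcal{O}_n)$ is the collection of all sets $\Lambda_n(t,W)$ (all $t$, all windows $W$, all choices of star map); its elements are called cyclotomic model sets. *)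

(* Defs.v *)
From HB Require Import structures.
From mathcomp Require Import all_boot all_order all_algebra.
From mathcomp Require Import complex.
From mathcomp Require Import all_classical all_reals all_analysis.

Set Implicit Arguments.
Unset Strict Implicit.
Unset Printing Implicit Defensive.

Import Order.TTheory GRing.Theory Num.Theory.
Import numFieldNormedType.Exports.

Local Open Scope classical_set_scope.
Local Open Scope ring_scope.

(** The real numbers are an arbitrary [R : realType],
    the complex numbers are [R[i]], and the plane is ['cV[R]_2]. *)

Section CyclotomicFields.
Variable R : realType.
Implicit Types (n : nat) (x : R[i]) (K : set R[i]) (s : R[i] -> R[i]).

Definition field_gen x : set R[i] :=
  smallest (fun A : set R[i] => divring_closed [in A]) [set x].

Definition ring_gen x : set R[i] :=
  smallest (fun A : set R[i] => subring_closed [in A]) [set x].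

(** exp (2 pi i / n), for 0 < n *)
Definition zeta n : R[i] :=
  Complex (cos (2 * pi / n%:R)) (sin (2 * pi / n%:R)).

Definition zeta_re n : R[i] := zeta n + conjc (zeta n).

Definition KK n : set R[i] := field_gen (zeta n).
Definition kk n : set R[i] := field_gen (zeta_re n).
Definition OO n : set R[i] := ring_gen (zeta n).
Definition oo n : set R[i] := ring_gen (zeta_re n).

(** Elements of Gal(K/Q) are represented by maps on all of [R[i]], of which
    only the restriction to [K] is relevant. *)
Definition in_Gal K s : Prop :=
  [/\ set_bij K K s,
      (forall x y, K x -> K y -> s (x + y) = s x + s y),
      (forall x y, K x -> K y -> s (x * y) = s x * s y)
    & (forall q : rat, s (ratr q) = ratr q)].

(** The number [k] with [phi(n)/2 = k + 1], for [2 < n]. *)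
Definition codim n : nat := (totient n)./2.-1.

(** A family with one automorphism from each pair of complex conjugate elements
    of Gal(K_n/Q), starting with the identity; it is indexed from 0, so that
    [sigma ord0] is sigma_1. *)
Definition conj_representatives n (sigma : 'I_(codim n).+1 -> R[i] -> R[i]) :
    Prop :=
  [/\ {in KK n, sigma ord0 =1 id},
      (forall i, in_Gal (KK n) (sigma i))
    & (forall tau, in_Gal (KK n) tau ->
        exists! i, {in KK n, sigma i =1 tau} \/
                   {in KK n, sigma i =1 conjc \o tau})].

End CyclotomicFields.

Arguments zeta R n : clear implicits.
Arguments zeta_re R n : clear implicits.
Arguments KK R n : clear implicits.
Arguments kk R n : clear implicits.
Arguments OO R n : clear implicits.
Arguments oo R n : clear implicits.

Section ModelSets.
Variable R : realType.
Implicit Types (n : nat) (z : R[i]).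

Definition plane_of z : 'cV[R]_2 :=
  \col_(i < 2) (if i == 0 then complex.Re z else complex.Im z).

(** (R^2)^k is ['M[R]_(2, k)], column [j] being the [j]-th component; its
    library topology is the product topology, and it is a point if [k = 0]. *)
Definition star n (sigma : 'I_(codim n).+1 -> R[i] -> R[i]) z :
    'M[R]_(2, codim n) :=
  \matrix_(i < 2, j < codim n) plane_of (sigma (lift ord0 j) z) i 0.

Definition window (k : nat) (W : set 'M[R]_(2, k)) : Prop :=
  [/\ W° !=set0, W° `<=` W, W `<=` closure W° & compact (closure W°)].

Definition Lambda n sigma (t : 'cV[R]_2) (W : set 'M[R]_(2, codim n)) :
    set 'cV[R]_2 :=
  [set t + plane_of z | z in [set z | OO R n z /\ W (star sigma z)]].

Definition cyclotomic_model_sets n : set (set 'cV[R]_2) :=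
  [set L | exists sigma t W,
    [/\ @conj_representatives R n sigma, window W & L = Lambda sigma t W]].

End ModelSets.

(** A polygon with [m] vertices ([2 < m]) is given by the cyclic sequence
    [v : 'I_m -> 'cV[R]_2] of its vertices, with sides from [v i] to
    [v (ordS i)]. *)
Section Polygons.
Variables (R : realType) (m : nat).
Implicit Types (a b c u w : 'cV[R]_2) (v : 'I_m -> 'cV[R]_2).

(** The norm [`|u|] of the library is the sup norm, hence these definitions. *)
Definition dot u w : R := (u^T *m w) 0 0.
Definition enorm u : R := Num.sqrt (dot u u).
Definition angle u w : R := acos (dot u w / (enorm u * enorm w)).

(** Twice the signed area of the triangle a b c. *)
Definition orient a b c : R :=
  (b - a) 0 0 * (c - a) 1 0 - (b - a) 1 0 * (c - a) 0 0.

(** The vertices other than the endpoints of a side all lie strictly on the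
    same side of the line through it ([j = k] rules out points on the line);
    no orientation of the boundary is imposed. *)
Definition convex_polygon v : Prop :=
  forall i j k : 'I_m, j \notin [:: i; ordS i] -> k \notin [:: i; ordS i] ->
    0 < orient (v i) (v (ordS i)) (v j) * orient (v i) (v (ordS i)) (v k).

Definition side_length v (i : 'I_m) : R := enorm (v (ordS i) - v i).

Definition interior_angle v (i : 'I_m) : R :=
  angle (v (ord_pred i) - v i) (v (ordS i) - v i).

Definition regular_polygon v : Prop :=
  [/\ convex_polygon v,
      (forall i j, side_length v i = side_length v j)
    & (forall i j, interior_angle v i = interior_angle v j)].

Definition affinely_regular v : Prop :=
  exists (p : 'I_m -> 'cV[R]_2) (A : 'M[R]_2) (t : 'cV[R]_2),
    [/\ regular_polygon p, \det A != 0 & forall i, v i = A *m p i + t].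

Definition polygon_in (S : set 'cV[R]_2) v : Prop :=
  convex_polygon v /\ forall i, S (v i).

End Polygons.

(* Main.v *)
Require Import Defs.
From HB Require Import structures.
From mathcomp Require Import all_boot all_order all_algebra.
From mathcomp Require Import all_field zify ring lra.
From mathcomp Require Import complex.
From mathcomp Require Import all_classical all_reals all_analysis.

Set Implicit Arguments.
Unset Strict Implicit.
Unset Printing Implicit Defensive.

(** Everything is compared with one arithmetic condition: the number
    [zeta_re R m], that is [2 cos (2 pi / m)], lies in [KK R n].

    From a polygon to arithmetic.  In a regular [m]-gon the side vectors are
    obtained from one another by multiplication with a fixed complex number [w],
    and convexity separates the vertices, so [w] is a primitive [m]-th root of
    unity.  The chord from vertex 0 to vertex 3 is parallel to the side from
    vertex 1 to vertex 2, in the ratio [1 + w + w^-1].  Affine maps preserve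
    ratios of parallel vectors, so if the vertices are a translate of elements
    of [OO R n], this ratio is in [KK R n] ([affinely_regular_KK]); and
    [zeta_re R m] is a polynomial in [w + w^-1].

    From the condition to divisibility.  Let [zeta_re R m] be in [KK R n].  If
    [k] is prime to [m * n] and [k = 1] modulo [n], then the automorphism which
    raises roots of unity to the power [k] fixes [zeta_n], hence [zeta_re R m],
    hence it sends [zeta_m] to itself or to its inverse: [k] is [1] or [-1]
    modulo [m] ([zeta_re_KK_divisibility]).  Such [k] reach every unit modulo [m]
    which is [1] modulo [gcdn m n], so there are at most two of the latter, and
    this forces [m] to be 3, 4 or 6, or [gcdn m n] to be [m], or [m / 2] with
    [m / 2] odd ([divisibility_from_units]).

    From divisibility to the inclusions.  Divisibility puts [zeta_m] in [OO R n],
    unless [m] is 3, 4 or 6, in which case [zeta_re R m] is an integer.  The real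
    elements of [OO R n] and [KK R n] are in [oo R n] and [kk R n], because
    [zeta_n] is a root of a monic quadratic polynomial over [oo R n].

    From divisibility to a polygon.  Some affinely regular [m]-gon has its
    vertices [b_i] in [OO R n]: the powers of [zeta_m] or, if [m] is 3, 4 or 6,
    their images under the real linear map which fixes 1 and sends [zeta_m] to
    [zeta_n].  It remains to move it into the model set by a similarity
    [b |-> c + d * b] with [c] and [d] in [OO R n] ([window_fit]).  Dirichlet's
    box principle provides [d <> 0] all of whose conjugates, except itself and
    its complex conjugate, are small.  If real coefficients were allowed,
    interpolation would give a polynomial [P] such that [c = d * P(zeta_n)] is
    mapped by the star map to a prescribed interior point of the window;
    rounding the coefficients of [P] moves the image of [c] by an amount
    controlled by the small conjugates of [d], and so does adding [d * b_i]. *)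

(** * Residues congruent to 1 *)

Definition divisibility_condition m n : Prop :=
  [\/ m \in [:: 3; 4; 6], m %| n
     | exists d, [/\ m = 2 * d, odd d & d %| n]].

Lemma coprime_mul_succ d c : coprime (d * c).+1 d.
Proof. by rewrite coprime_sym /coprime mulnC -addn1 gcdnMDl gcdn1. Qed.

(** The Chinese remainder theorem for two moduli which need not be coprime: the
    residues modulo [m] and [n] have to agree only modulo the gcd, and Bezout's
    relation gives the common solution. *)
Lemma unit_lift m n t : 0 < n -> coprime (gcdn m n * t).+1 m ->
  exists k, [/\ coprime k (m * n), k = 1 %[mod n] &
    k = (gcdn m n * t).+1 %[mod m]].
Proof.
move=> n_gt0 cop; have [a b eab _] := egcdnP m n_gt0.
have ek : (n * (a * t)).+1 = (gcdn m n * t).+1 %[mod m].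
  by rewrite mulnA [n * a]mulnC eab gcdnC mulnDl mulnAC -addnS modnMDl.
exists (n * (a * t)).+1; split=> //.
  by rewrite coprimeMr -coprime_modl ek coprime_modl cop coprime_mul_succ.
by rewrite mulnC -addn1 modnMDl.
Qed.

Lemma coprime_succ_mul q s c : prime q -> ~~ (q %| (s * c).+1) ->
  coprime (s * c).+1 (q * s).
Proof.
move=> q_pr nq; rewrite coprimeMr coprime_sym prime_coprime // nq /=.
exact: coprime_mul_succ.
Qed.

(** For the other [m] one of 2, [r + 1], [r + 2], where [r] is [m./2], is a unit
    different from 1 and -1: 2 if [m] is odd, and if [m] is even, [r + 1] or
    [r + 2] according to whether [r] is even or odd. *)
Lemma only_pm1_units m : 2 < m ->
  (forall u, coprime u.+1 m -> m %| u \/ m %| u.+2) -> m \in [:: 3; 4; 6].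
Proof.
move=> m_gt2 H; have [r em] : exists r, m = r.*2 + odd m.
  by exists m./2; rewrite addnC odd_double_half.
case: (boolP (odd m)) em => [om em|/negbTE em0 em].
  have [|/dvdn_leq|/dvdn_leq] := H 1.
  - by rewrite prime_coprime // dvdn2 om.
  - by move=> /(_ isT); lia.
  - by move=> /(_ isT) ?; have -> : m = 3 by lia.
rewrite addn0 in em; case: (boolP (odd r)) => r_odd.
  have [|/dvdn_leq|/dvdn_leq] := H r.+1.
  - rewrite em -mul2n coprimeMr coprimen2 /= negbK r_odd /=.
    by rewrite coprime_sym /coprime -addn2 gcdnDl -/(coprime _ _) coprimen2.
  - by move=> /(_ isT); lia.
  - by move=> /(_ isT) ?; have -> : m = 6 by lia.
have [|/dvdn_leq|/dvdn_leq] := H r.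
- rewrite em -mul2n coprimeMr coprimen2 /= r_odd /=.
  by rewrite coprime_sym /coprime -addn1 gcdnDl gcdn1.
- by move: m_gt2; rewrite em; case: (r) => // ? _ /(_ isT); lia.
- by move=> /(_ isT) ?; have -> : m = 4 by lia.
Qed.

(** The kernel of the reduction from the units modulo [d * e] to the units
    modulo [d] has [totient (d * e) / totient d] elements, so its triviality is an
    equality of totients; the proof exhibits the kernel elements
    [1 + c * (d * e) / q] with [c] at most 2, for [q] a prime factor of [e]. *)
Lemma trivial_kernel_index d e : 0 < d -> 0 < e ->
  (forall t, coprime (d * t).+1 (d * e) -> e %| t) ->
  e = 1 \/ e = 2 /\ odd d.
Proof.
move=> d_gt0 e_gt0 H.
(* [d * f] is [(d * e) / q] *)
have step q f : prime q -> e = q * f -> q = 2 /\ odd (d * f).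
  move=> q_pr ef; have f_gt0 : 0 < f by move: e_gt0; rewrite ef; case: (f); lia.
  have q_gt1 := prime_gt1 q_pr.
  have copr c : ~~ (q %| (d * f * c).+1) -> q %| c.
    move=> nq; have := coprime_succ_mul q_pr nq.
    by rewrite mulnCA -ef -mulnA => /H; rewrite ef mulnC dvdn_pmul2l.
  have q_succ : q %| (d * f).+1.
    rewrite -[d * f]muln1; apply/negPn/negP=> /copr.
    by rewrite dvdn1 => /eqP q1; rewrite q1 in q_gt1.
  have q_ndvd : ~~ (q %| d * f).
    by apply/negP=> qs; move: q_succ; rewrite -addn1 dvdn_addr // dvdn1; lia.
  have : q %| 2.
    apply: copr; apply: contra q_ndvd => q2.
    by move: q2; rewrite muln2 -addnn -addSn dvdn_addr.
  rewrite dvdn_prime2 // => /eqP q2; split=> //.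
  by rewrite q2 dvdn2 negbK in q_ndvd.
have [e_le1|e_gt1] := leqP e 1; first by left; lia.
have [_ /divnK ef] := (pdiv_prime e_gt1, pdiv_dvd e).
rewrite mulnC in ef; have [q2 odf] := step _ _ (pdiv_prime e_gt1) (esym ef).
move: odf ef; rewrite q2 oddM => /andP[od of2] ef; right; split=> //.
have [f_le1|f_gt1] := leqP (e %/ 2) 1; first by lia.
have [|q'2 _] := step _ (2 * (e %/ 2 %/ pdiv (e %/ 2))) (pdiv_prime f_gt1).
  by rewrite mulnCA [pdiv _ * _]mulnC divnK ?pdiv_dvd.
by move: (pdiv_dvd (e %/ 2)); rewrite q'2 dvdn2 of2.
Qed.

(** Let [d] be [gcdn m n].  If [d] divides 2, every unit modulo [m] is [1] modulo
    [d], so all units are [1] or [-1].  If not, [-1] is not [1] modulo [d], so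
    the units congruent to [1] modulo [d] are trivial. *)
Lemma divisibility_from_units m n : 2 < m -> 0 < n ->
    (forall k, coprime k (m * n) -> k = 1 %[mod n] ->
       k = 1 %[mod m] \/ m %| k.+1) ->
  divisibility_condition m n.
Proof.
move=> m_gt2 n_gt0 H; set d := gcdn m n.
have H' t : coprime (d * t).+1 m -> m %| d * t \/ m %| (d * t).+2.
  move=> /(unit_lift n_gt0) [k [cop k1 kt]].
  have [k1m|mk] := H k cop k1.
    left; have : (d * t).+1 == 1 %[mod m] by rewrite -kt k1m.
    by rewrite eqn_mod_dvd // subn1.
  right; rewrite /dvdn -addn1 -modnDml -kt modnDml addn1; exact: mk.
have dm : d %| m := dvdn_gcdl _ _; have dn : d %| n := dvdn_gcdr _ _.
have d_gt0 : 0 < d by rewrite gcdn_gt0 n_gt0 orbT.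
have [d2|nd2] := boolP (d %| 2).
  apply: Or31; apply: only_pm1_units m_gt2 _ => u copu.
  have /dvdnP[t ut] : d %| u.
    have /primeP[_ /(_ d d2)] : prime 2 by [].
    case/pred2P=> d12; rewrite d12 ?dvd1n //.
    rewrite d12 in dm; have := coprime_dvdr dm copu.
    by rewrite coprimen2 dvdn2.
  by have := H' t; rewrite mulnC -ut; apply.
have [e em] : exists e, m = d * e by exists (m %/ d); rewrite mulnC divnK.
have e_gt0 : 0 < e by case: (e) em => //; lia.
have [|e1|[e2 od]] := @trivial_kernel_index d e d_gt0 e_gt0.
- move=> t; rewrite -em => /H' [|mt]; first by rewrite em dvdn_pmul2l.
  case/negP: nd2; have := dvdn_trans dm mt.
  by rewrite -addn2 dvdn_addr ?dvdn_mulr.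
- by apply: Or32; rewrite em e1 muln1.
- by apply: Or33; exists d; rewrite em e2 mulnC.
Qed.

Import Order.TTheory GRing.Theory Num.Theory.
Import numFieldNormedType.Exports.
Import ComplexField.Normc.

Local Open Scope classical_set_scope.
Local Open Scope ring_scope.

(** * Generated rings and fields as values of integer polynomials *)

Definition evalZ (F : comNzRingType) (x : F) (f : {poly int}) : F :=
  (map_poly intr f).[x].

Section EvalZ.
Variables (F : comNzRingType) (x : F).
Implicit Types f g : {poly int}.

Lemma evalZD f g : evalZ x (f + g) = evalZ x f + evalZ x g.
Proof. by rewrite /evalZ rmorphD hornerD. Qed.

Lemma evalZN f : evalZ x (- f) = - evalZ x f.
Proof. by rewrite /evalZ rmorphN hornerN. Qed.

Lemma evalZB f g : evalZ x (f - g) = evalZ x f - evalZ x g.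
Proof. by rewrite evalZD evalZN. Qed.

Lemma evalZM f g : evalZ x (f * g) = evalZ x f * evalZ x g.
Proof. by rewrite /evalZ rmorphM hornerM. Qed.

Lemma evalZC c : evalZ x c%:P = c%:~R.
Proof. by rewrite /evalZ map_polyC hornerC. Qed.

Lemma evalZ0 : evalZ x 0 = 0.
Proof. by rewrite -polyC0 evalZC. Qed.

Lemma evalZ1 : evalZ x 1 = 1.
Proof. by rewrite -polyC1 evalZC. Qed.

Lemma evalZX : evalZ x 'X = x.
Proof. by rewrite /evalZ map_polyX hornerX. Qed.

Lemma evalZ_exp f k : evalZ x (f ^+ k) = evalZ x f ^+ k.
Proof. by rewrite /evalZ rmorphXn horner_exp. Qed.

Lemma evalZ_comp f g : evalZ x (f \Po g) = evalZ (evalZ x g) f.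
Proof. by rewrite /evalZ map_comp_poly horner_comp. Qed.

End EvalZ.

Lemma evalZ_rmorph (F G : comNzRingType) (s : {rmorphism F -> G}) x f :
  s (evalZ x f) = evalZ (s x) f.
Proof.
rewrite /evalZ -horner_map -map_poly_comp; congr (_.[_]).
by apply: eq_map_poly => c /=; rewrite rmorph_int.
Qed.

Section Generators.
Variable R : realType.
Implicit Types (x y z : R[i]) (A : set R[i]).

Lemma ring_gen_sub x A : subring_closed [in A] -> A x -> ring_gen x `<=` A.
Proof. by move=> Ar Ax; apply: smallest_sub => // y ->. Qed.

Lemma field_gen_sub x A : divring_closed [in A] -> A x -> field_gen x `<=` A.
Proof. by move=> Ar Ax; apply: smallest_sub => // y ->. Qed.

Lemma ring_gen_closed x : subring_closed [in ring_gen x].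
Proof.
split; rewrite ?inE.
- by move=> A [[]]; rewrite inE.
- move=> y z'; rewrite !inE => Hy Hz A HA; case: (HA) => -[_ AB _] _.
  by have := AB y z'; rewrite !inE; apply; [exact: Hy | exact: Hz].
- move=> y z'; rewrite !inE => Hy Hz A HA; case: (HA) => -[_ _ AM] _.
  by have := AM y z'; rewrite !inE; apply; [exact: Hy | exact: Hz].
Qed.

Lemma ring_genP x z : ring_gen x z <-> exists f, z = evalZ x f.
Proof.
split; last first.
  case=> f ->; have [A1 AB AM] := ring_gen_closed x.
  have A0 : 0 \in ring_gen x by rewrite -(subrr 1); apply: AB.
  have AN y : y \in ring_gen x -> - y \in ring_gen x.
    by move=> ?; rewrite -sub0r; apply: AB.
  have AD y z' : y \in ring_gen x -> z' \in ring_gen x -> y + z' \in ring_gen x.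
    by move=> ? ?; rewrite -[z']opprK; apply/AB/AN.
  have An (k : nat) : k%:R \in ring_gen x.
    by elim: k => [//|k IH]; rewrite -addn1 natrD; apply: AD.
  have Ax : x \in ring_gen x by rewrite inE => A [_]; apply.
  suff : evalZ x f \in ring_gen x by rewrite inE.
  elim/poly_ind: f => [|f c IH]; first by rewrite evalZ0.
  rewrite evalZD evalZM evalZX evalZC; apply: AD; first exact: AM.
  by case: c => k; rewrite ?NegzE ?mulrNz; [|apply: AN]; apply: An.
apply: (@ring_gen_sub x [set y | exists f, y = evalZ x f]); last first.
  by exists 'X; rewrite evalZX.
split; rewrite ?inE.
- by exists 1; rewrite evalZ1.
- move=> y z'; rewrite !inE => -[f ->] [g ->].
  by exists (f - g); rewrite evalZB.
- move=> y z'; rewrite !inE => -[f ->] [g ->].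
  by exists (f * g); rewrite evalZM.
Qed.

Lemma field_gen_closed x : divring_closed [in field_gen x].
Proof.
split; rewrite ?inE.
- by move=> A [[]]; rewrite inE.
- move=> y z'; rewrite !inE => Hy Hz A HA; case: (HA) => -[_ AB _] _.
  by have := AB y z'; rewrite !inE; apply; [exact: Hy | exact: Hz].
- move=> y z'; rewrite !inE => Hy Hz A HA; case: (HA) => -[_ _ AM] _.
  by have := AM y z'; rewrite !inE; apply; [exact: Hy | exact: Hz].
Qed.

(** Quotients of polynomial values are closed under division whether or not
    [x] is algebraic, which spares a proof that [field_gen x] consists of
    polynomial values. *)
Lemma field_genP x z : field_gen x z <->
  exists f g, evalZ x g != 0 /\ z = evalZ x f / evalZ x g.
Proof.
have [A1 AB AV] := field_gen_closed x.
split; last first.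
  move=> [f [g [_ ->]]]; apply: set_mem.
  have sub : ring_gen x `<=` field_gen x.
    apply: ring_gen_sub; last by move=> A [_]; apply.
    split=> // y z' yA zA; rewrite -[z']invrK; apply: (AV) => //.
    by rewrite -[z'^-1]mul1r; apply: AV.
  by apply: AV; rewrite inE; apply: sub; apply/ring_genP; eexists.
pose FA := [set y | exists f g, evalZ x g != 0 /\ y = evalZ x f / evalZ x g].
apply: (@field_gen_sub x FA); last first.
  by exists 'X, 1; rewrite evalZ1 oner_neq0 evalZX divr1.
split; rewrite ?inE.
- by exists 1, 1; rewrite evalZ1 oner_neq0 divr1.
- move=> y z'; rewrite !inE => -[f [g [g0 ->]]] [f' [g' [g'0 ->]]].
  exists (f * g' - f' * g), (g * g').
  rewrite evalZB !evalZM mulf_neq0 //; split=> //; field.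
  by rewrite g0 g'0.
- move=> y z'; rewrite !inE => -[f [g [g0 ->]]] [f' [g' [g'0 ->]]].
  have [f'0|f'0] := eqVneq (evalZ x f') 0.
    exists 0, 1; rewrite f'0 mul0r invr0 mulr0 evalZ0 mul0r.
    by rewrite evalZ1 oner_neq0.
  exists (f * g'), (g * f'); rewrite !evalZM mulf_neq0 //; split=> //; field.
  by rewrite g0 f'0 g'0.
Qed.

Lemma ring_gen_gen x : ring_gen x x.
Proof. by apply/ring_genP; exists 'X; rewrite evalZX. Qed.

Lemma ring_genD x y z : ring_gen x y -> ring_gen x z -> ring_gen x (y + z).
Proof.
move=> /ring_genP[f ->] /ring_genP[g ->]; apply/ring_genP.
by exists (f + g); rewrite evalZD.
Qed.

Lemma ring_genB x y z : ring_gen x y -> ring_gen x z -> ring_gen x (y - z).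
Proof.
move=> /ring_genP[f ->] /ring_genP[g ->]; apply/ring_genP.
by exists (f - g); rewrite evalZB.
Qed.

Lemma ring_genM x y z : ring_gen x y -> ring_gen x z -> ring_gen x (y * z).
Proof.
move=> /ring_genP[f ->] /ring_genP[g ->]; apply/ring_genP.
by exists (f * g); rewrite evalZM.
Qed.

Lemma ring_gen_int x (c : int) : ring_gen x c%:~R.
Proof. by apply/ring_genP; exists c%:P; rewrite evalZC. Qed.

Lemma ring_genX x y k : ring_gen x y -> ring_gen x (y ^+ k).
Proof.
by move=> /ring_genP[f ->]; apply/ring_genP; exists (f ^+ k); rewrite evalZ_exp.
Qed.

Lemma ring_gen_trans x y : ring_gen y x -> ring_gen x `<=` ring_gen y.
Proof.
move=> /ring_genP[g ->] _ /ring_genP[f ->].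
by apply/ring_genP; exists (f \Po g); rewrite evalZ_comp.
Qed.

Lemma ring_field_gen x : ring_gen x `<=` field_gen x.
Proof.
move=> _ /ring_genP[f ->]; apply/field_genP; exists f, 1.
by rewrite evalZ1 oner_neq0 divr1.
Qed.

Lemma field_gen_div x y z :
  field_gen x y -> field_gen x z -> field_gen x (y / z).
Proof.
by have [_ _ /(_ y z)] := field_gen_closed x; rewrite !inE => H ? ?; apply: H.
Qed.

Lemma field_gen_trans x y : field_gen y x -> field_gen x `<=` field_gen y.
Proof. exact: field_gen_sub (field_gen_closed y). Qed.

End Generators.

(** * Conjugating a root of unity *)

Lemma evalZ_ratr (F : numFieldType) (z : F) f :
  evalZ z f = (map_poly ratr (map_poly intr f : {poly rat})).[z].
Proof.
rewrite /evalZ -map_poly_comp; congr (_.[_]).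
by apply: eq_map_poly => c /=; rewrite rmorph_int.
Qed.

Section CyclotomicRoots.
Variable F : numFieldType.
Implicit Types (z : F) (f : {poly int}).

Lemma evalZ_Cyclotomic N z : N.-primitive_root z -> evalZ z 'Phi_N = 0.
Proof.
move=> zN; have N_gt0 := prim_order_gt0 zN.
have prodE d : (0 < d)%N -> z ^+ d - 1 = \prod_(e <- divisors d) evalZ z 'Phi_e.
  move=> d_gt0; transitivity (evalZ z ('X^d - 1)).
    by rewrite evalZB evalZ_exp evalZX evalZ1.
  rewrite -prod_Cyclotomic //; elim/big_ind2: _ => [|a b c e <- <-|//].
    exact: evalZ1.
  exact: evalZM.
have /eqP := prodE _ N_gt0; rewrite (prim_expr_order zN) subrr eq_sym.
rewrite prodf_seq_eq0 => /hasP[d]; rewrite -dvdn_divisors //= => dN /eqP zd.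
have d_gt0 := dvdn_gt0 N_gt0 dN.
suff <- : d = N by [].
apply/eqP; rewrite eqn_dvd dN (prim_order_dvd zN) -subr_eq0 prodE //.
rewrite prodf_seq_eq0; apply/hasP; exists d; last by rewrite /= zd.
by rewrite -dvdn_divisors.
Qed.

(** Irreducibility of the cyclotomic polynomial over the rationals, transported
    from the algebraic numbers to [F]: the gcd of [f] and ['Phi_N] is a rational
    polynomial with the root [z], so it is not constant and has a root in
    [algC]; this root is a primitive [N]-th root of unity whose minimal
    polynomial is ['Phi_N]. *)
Lemma Cyclotomic_dvdp N z f : N.-primitive_root z -> evalZ z f = 0 ->
  map_poly intr 'Phi_N %| (map_poly intr f : {poly rat}).
Proof.
move=> zN fz; set P := map_poly _ 'Phi_N; set Q := map_poly _ f.
pose g := gcdp Q P.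
have Pz : root (map_poly ratr P) z.
  by rewrite /root -evalZ_ratr evalZ_Cyclotomic.
have Qz : root (map_poly ratr Q) z by rewrite /root -evalZ_ratr fz.
have gz : root (map_poly ratr g) z.
  by rewrite gcdp_map root_gcd Qz.
have P0 : P != 0 by rewrite monic_neq0 // monic_map // Cyclotomic_monic.
have g0 : g != 0 by rewrite gcdp_eq0 negb_and P0 orbT.
have size_g : size (map_poly ratr g : {poly algC}) != 1%N.
  have := root_size_gt1 _ gz; rewrite map_poly_eq0 g0 size_map_poly => /(_ isT).
  by rewrite size_map_poly; case: size => [|[]].
have /closed_rootP[w gw] := size_g.
have [x xN] := C_prim_root_exists (prim_order_gt0 zN).
have wN : N.-primitive_root w.
  rewrite -(root_cyclotomic xN) -(Cintr_Cyclotomic xN) /root.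
  rewrite -[_.[w]]/(evalZ w _) evalZ_ratr.
  by move: gw; rewrite gcdp_map root_gcd => /andP[].
have [p [minp _] pP] := minCpolyP w.
have pE : p = P.
  apply: (map_inj_poly (fmorph_inj (ratr : rat -> algC)) (rmorph0 _)).
  transitivity (minCpoly w); first exact: esym minp.
  rewrite (minCpoly_cyclotomic wN) -(Cintr_Cyclotomic wN) -map_poly_comp.
  by apply: eq_map_poly => c /=; rewrite rmorph_int.
by rewrite pE in pP; apply: dvdp_trans (dvdp_gcdl Q P); rewrite -pP.
Qed.

(** The effect of the automorphism of the [N]-th cyclotomic field that raises
    roots of unity to the power [k], in terms of polynomial relations, so that no
    automorphism has to be constructed. *)
Lemma evalZ_conjugate N k z f : N.-primitive_root z -> coprime k N ->
  evalZ z f = 0 -> evalZ (z ^+ k) f = 0.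
Proof.
move=> zN cop /(Cyclotomic_dvdp zN)/dvdpP[h fE].
rewrite evalZ_ratr fE rmorphM hornerM -evalZ_ratr.
by rewrite evalZ_Cyclotomic ?mulr0 // prim_root_exp_coprime.
Qed.

End CyclotomicRoots.

(** * The numbers zeta_n and the real elements of Z[zeta_n] *)

Lemma unity_neq0 (F : fieldType) (w : F) n : (0 < n)%N -> w ^+ n = 1 -> w != 0.
Proof.
move=> n_gt0 wn; apply: contra_eq_neq wn => ->.
by rewrite expr0n gtn_eqF // eq_sym oner_eq0.
Qed.

Lemma conjc_unity (R : rcfType) (w : R[i]) n : (0 < n)%N -> w ^+ n = 1 ->
  conjc w = w^-1.
Proof.
move=> n_gt0 wn.
have w0 := unity_neq0 n_gt0 wn.
apply: (mulfI w0); rewrite mulfV //; apply/eqP.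
rewrite -(pexpr_eq1 n_gt0) ?mulcJ_ge0 // exprMn -rmorphXn.
by rewrite wn rmorph1 mul1r.
Qed.

Section Zeta.
Variable R : realType.
Implicit Types (x y z w : R[i]) (n k : nat) (a b : R).

Definition cis a : R[i] := Complex (cos a) (sin a).

Lemma cisD a b : cis (a + b) = cis a * cis b.
Proof. by rewrite /cis cosD sinD; simpc; rewrite [sin a * _ + _]addrC. Qed.

Lemma zetaX n k : zeta R n ^+ k = cis (2 * (pi * k%:R / n%:R)).
Proof.
elim: k => [|k IH]; first by rewrite mulr0 mul0r mulr0 /cis cos0 sin0.
rewrite exprSr IH -cisD -natr1; congr cis; ring.
Qed.

Lemma zeta_expn n : (0 < n)%N -> zeta R n ^+ n = 1.
Proof.
move=> n_gt0; rewrite zetaX mulfK ?pnatr_eq0 -?lt0n //.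
by rewrite mulr_natl /cis cos2pi sin2pi.
Qed.

Lemma cis_double_neq1 a : 0 < a < pi -> cis (2 * a) != 1.
Proof.
move=> /sin_gt0_pi sin_a; apply/eqP => -[+ _].
rewrite mulr_natl cos_mulr2n => h.
have := cos2Dsin2 a; nra.
Qed.

Lemma zeta_prim n : (0 < n)%N -> n.-primitive_root (zeta R n).
Proof.
move=> n_gt0; rewrite /primitive_root_of_unity n_gt0 /=; apply/forallP => i.
rewrite unity_rootE; have [->|i_neq] := eqVneq i.+1 n.
  by rewrite zeta_expn // eqxx.
have i_lt : (i.+1 < n)%N by rewrite ltn_neqAle i_neq ltn_ord.
rewrite eqbF_neg zetaX; apply: cis_double_neq1.
have pi0 := pi_gt0 R.
have n0 : 0 < n%:R :> R by rewrite ltr0n.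
rewrite divr_gt0 ?mulr_gt0 ?ltr0n //=.
by rewrite ltr_pdivrMr // ltr_pM2l // ltr_nat.
Qed.

Lemma zeta_neq0 n : (0 < n)%N -> zeta R n != 0.
Proof. by move=> n_gt0; exact: unity_neq0 (zeta_expn n_gt0). Qed.

Lemma zeta_mulX m n : (0 < n)%N -> zeta R (m * n) ^+ n = zeta R m.
Proof.
move=> n_gt0; rewrite zetaX -[RHS]expr1 zetaX natrM; congr cis.
have [->|m0] := eqVneq m 0%N; first by rewrite mul0r invr0 !mulr0.
by field; rewrite !pnatr_eq0 m0 -lt0n.
Qed.

Lemma zeta_reE n : (0 < n)%N -> zeta_re R n = zeta R n + (zeta R n)^-1.
Proof.
by move=> n_gt0; rewrite /zeta_re (conjc_unity n_gt0 (zeta_expn n_gt0)).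
Qed.

Lemma conjc_zeta_neq n : (2 < n)%N -> conjc (zeta R n) != zeta R n.
Proof.
move=> n_gt2; have n_gt0 : (0 < n)%N by lia.
rewrite (conjc_unity n_gt0 (zeta_expn n_gt0)); apply/eqP => zV.
have := prim_order_dvd (zeta_prim n_gt0) 2.
rewrite expr2 -{1}zV mulVf ?zeta_neq0 // eqxx => /dvdn_leq; lia.
Qed.

(** The powers satisfy the recurrence
    [x^(k+2) + x^-(k+2) = (x + x^-1) (x^(k+1) + x^-(k+1)) - (x^k + x^-k)]. *)
Lemma symmetric_power x k : x != 0 -> ring_gen (x + x^-1) (x ^+ k + x ^- k).
Proof.
move=> x0; suff [] : ring_gen (x + x^-1) (x ^+ k + x ^- k) /\
  ring_gen (x + x^-1) (x ^+ k.+1 + x ^- k.+1) by [].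
elim: k => [|k [IH1 IH2]].
  split; last exact: ring_gen_gen.
  rewrite expr0 invr1; exact: (ring_gen_int 2).
split=> //.
have -> : x ^+ k.+2 + x ^- k.+2 =
    (x + x^-1) * (x ^+ k.+1 + x ^- k.+1) - (x ^+ k + x ^- k).
  by rewrite !exprS; field; rewrite expf_neq0.
by apply: ring_genB => //; apply: ring_genM => //; exact: ring_gen_gen.
Qed.

Lemma conjc_zeta_re n : conjc (zeta_re R n) = zeta_re R n.
Proof.
rewrite /zeta_re; move: (zeta R n) => z.
by rewrite rmorphD /= conjcK addrC.
Qed.

Lemma oo_real n z : oo R n z -> conjc z = z.
Proof.
move=> /ring_genP[f ->]; rewrite evalZ_rmorph.
by congr evalZ; exact: conjc_zeta_re.
Qed.

(** [OO R n] is generated by 1 and [zeta_n] as a module over [oo R n], since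
    [zeta_n ^ 2 = zeta_re * zeta_n - 1]; as [zeta_n] is not real, a real
    [a + b * zeta_n] has [b = 0]. *)
Lemma OO_real n z : (2 < n)%N -> OO R n z -> conjc z = z -> oo R n z.
Proof.
move=> n_gt2; have n_gt0 : (0 < n)%N by lia.
suff H : OO R n z -> exists a b : R[i],
    [/\ oo R n a, oo R n b & z = a + b * zeta R n].
  move=> /H[a [b [oa ob ->]]].
  move: (@conjc_zeta_neq n n_gt2) (oo_real oa) (oo_real ob).
  (* generalized so that simplification does not unfold [zeta] *)
  move: (zeta R n) => x x_neq ea eb.
  rewrite rmorphD rmorphM /= ea eb => /addrI/eqP.
  rewrite -subr_eq0 -mulrBr mulf_eq0 subr_eq0 (negPf x_neq) orbF.
  by move=> /eqP ->; rewrite mul0r addr0.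
move=> /ring_genP[f ->]; elim/poly_ind: f => [|f c [a [b [oa ob fab]]]].
  exists 0, 0; rewrite evalZ0 mul0r addr0.
  by have := @ring_gen_int R (zeta_re R n) 0; split.
exists (c%:~R - b), (a + b * zeta_re R n); split.
- exact: ring_genB (ring_gen_int _) ob.
- by apply: ring_genD => //; apply: ring_genM => //; exact: ring_gen_gen.
- rewrite evalZD evalZM evalZX evalZC fab zeta_reE //.
  by field; exact: zeta_neq0.
Qed.

End Zeta.

(** * Real cyclotomic fields *)

Section Inclusions.
Variable R : realType.
Implicit Types (x y z : R[i]) (m n k : nat).

Lemma OO_conj n z : (0 < n)%N -> OO R n z -> OO R n (conjc z).
Proof.
move=> n_gt0 /ring_genP[f ->]; rewrite evalZ_rmorph.
apply: (@ring_gen_trans R (conjc (zeta R n))).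
  rewrite (conjc_unity n_gt0 (zeta_expn R n_gt0)).
  have -> : (zeta R n)^-1 = zeta R n ^+ n.-1.
    apply: (mulfI (zeta_neq0 R n_gt0)).
    by rewrite mulfV ?zeta_neq0 // -exprS prednK // zeta_expn.
  by apply: ring_genX; exact: ring_gen_gen.
by apply/ring_genP; exists f.
Qed.

(** Multiplying numerator and denominator by the conjugate of the denominator
    makes both real, which reduces the claim to [OO_real]. *)
Lemma KK_real n z : (2 < n)%N -> KK R n z -> conjc z = z -> kk R n z.
Proof.
move=> n_gt2 /field_genP[f [g [g0 zE]]] zr; have n_gt0 : (0 < n)%N by lia.
set u := evalZ (zeta R n) f in zE; set v := evalZ (zeta R n) g in g0 zE.
have Ou : OO R n u by apply/ring_genP; exists f.
have Ov : OO R n v by apply/ring_genP; exists g.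
have v'0 : conjc v != 0 by rewrite conjc_eq0.
have Ovv : oo R n (v * conjc v).
  apply: OO_real => //; first by apply: ring_genM => //; exact: OO_conj.
  by rewrite rmorphM /= conjcK mulrC.
have ouv : oo R n (u * conjc v).
  apply: OO_real => //; first by apply: ring_genM => //; exact: OO_conj.
  have -> : u * conjc v = z * (v * conjc v) by rewrite zE; field.
  by rewrite rmorphM /= zr (oo_real Ovv).
have -> : z = (u * conjc v) / (v * conjc v).
  by rewrite zE; field; rewrite g0 v'0.
by apply: field_gen_div; apply: ring_field_gen.
Qed.

Lemma oo_sub_OO n : (0 < n)%N -> oo R n `<=` OO R n.
Proof.
move=> n_gt0; apply: ring_gen_trans; rewrite /zeta_re; apply: ring_genD.
  exact: ring_gen_gen.
by apply: OO_conj => //; exact: ring_gen_gen.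
Qed.

Lemma kk_sub_KK n : (0 < n)%N -> kk R n `<=` KK R n.
Proof.
move=> n_gt0; apply: field_gen_trans; apply: ring_field_gen.
by apply: oo_sub_OO => //; exact: ring_gen_gen.
Qed.

(** With [Z := zeta_(m n)], a relation which expresses [zeta_m + 1 / zeta_m] by
    [zeta_n] is a polynomial relation for [Z].  It persists for [Z ^ k], and if
    [k = 1] modulo [n] then [zeta_n] is unchanged, so that [y = zeta_m ^ k]
    satisfies [y + 1/y = zeta_m + 1 / zeta_m]. *)
Lemma zeta_re_KK_divisibility m n : (2 < m)%N -> (2 < n)%N ->
  KK R n (zeta_re R m) ->
  divisibility_condition m n.
Proof.
move=> m_gt2 n_gt2 /field_genP[f [g [g0 fg]]].
have [m_gt0 n_gt0] : (0 < m)%N /\ (0 < n)%N by lia.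
apply: divisibility_from_units => // k cop k1.
set x := zeta R m in fg *; set Z := zeta R (m * n).
have Zprim : (m * n).-primitive_root Z.
  by apply: zeta_prim; rewrite muln_gt0 m_gt0.
have Zn : Z ^+ n = x by rewrite /Z zeta_mulX.
have Zm : Z ^+ m = zeta R n by rewrite /Z mulnC zeta_mulX.
have x0 : x != 0 := zeta_neq0 R m_gt0.
(* [h] expresses [(x ^ 2 + 1) * g = x * f], that is, [x + 1/x = f / g] *)
pose h := (('X ^+ n) ^+ 2 + 1) * (g \Po 'X ^+ m) - 'X ^+ n * (f \Po 'X ^+ m).
have hE w : evalZ w h =
    ((w ^+ n) ^+ 2 + 1) * evalZ (w ^+ m) g - w ^+ n * evalZ (w ^+ m) f.
  rewrite evalZB !evalZM evalZD evalZ1 evalZ_exp !evalZ_comp.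
  by rewrite !evalZ_exp evalZX.
have fE : evalZ (zeta R n) f = (x + x^-1) * evalZ (zeta R n) g.
  by rewrite -zeta_reE // fg divfK.
have hZ : evalZ Z h = 0 by rewrite hE Zn Zm fE; field.
have := evalZ_conjugate Zprim cop hZ.
rewrite hE [_ ^+ m]exprAC Zm [_ ^+ n]exprAC Zn.
have -> : zeta R n ^+ k = zeta R n.
  rewrite -[RHS]expr1; apply/eqP.
  by rewrite (eq_prim_root_expr (zeta_prim R n_gt0)) k1.
rewrite fE mulrA -mulrBl => /eqP; rewrite mulf_eq0 (negPf g0) orbF => E.
have : (x ^+ k - x) * (x ^+ k - x^-1) == 0.
  by move/eqP: E => E; apply/eqP; rewrite -[RHS]E; field.
have xprim := zeta_prim R m_gt0.
rewrite mulf_eq0 !subr_eq0 => /orP[]/eqP xk.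
  by left; apply/eqP; rewrite -(eq_prim_root_expr xprim) xk expr1.
by right; rewrite (prim_order_dvd xprim) exprS xk mulfV.
Qed.

(** For odd [d], [zeta_(2 d)] is [- zeta_d ^ ((d + 1) / 2)]. *)
Lemma divisibility_OO m n : (0 < n)%N ->
  divisibility_condition m n ->
  m \in [:: 3; 4; 6]%N \/ OO R n (zeta R m).
Proof.
move=> n_gt0; have H d : (d %| n)%N -> OO R n (zeta R d).
  move=> dn; have /dvdnP[c nE] := dn.
  have c_gt0 : (0 < c)%N by move: n_gt0; rewrite nE muln_gt0 => /andP[].
  rewrite -(zeta_mulX R d c_gt0) mulnC -nE.
  by apply: ring_genX; exact: ring_gen_gen.
case=> [|mn|[d [-> od dn]]]; first by left.
  by right; apply: H.
right; have d_gt0 := dvdn_gt0 n_gt0 dn.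
have prim2d : (2 * d).-primitive_root (zeta R (2 * d)).
  by apply: zeta_prim; rewrite muln_gt0.
have sq : (zeta R (2 * d) ^+ d) ^+ 2 = 1.
  by rewrite -exprM mulnC zeta_expn // muln_gt0 d_gt0.
have zd : zeta R (2 * d) ^+ d = -1.
  apply/eqP; move/eqP: sq; rewrite sqrf_eq1 => /orP[|//].
  by rewrite -(prim_order_dvd prim2d) => /dvdn_leq; lia.
have -> : zeta R (2 * d) = - (zeta R d) ^+ (d.+1)./2.
  rewrite -[zeta R d](@zeta_mulX R d 2) // [(d * 2)%N]mulnC -exprM.
  have -> : (2 * d.+1./2 = d.+1)%N by rewrite mul2n even_halfK //= od.
  by rewrite exprS zd mulrN1 opprK.
rewrite -sub0r; apply: ring_genB; first exact: (ring_gen_int 0).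
by apply: ring_genX; apply: H.
Qed.

Lemma zeta_re_int m : m \in [:: 3; 4; 6]%N ->
  exists c : int, zeta_re R m = c%:~R.
Proof.
move=> m346; have m_gt0 : (0 < m)%N.
  by move: m346; rewrite !inE => /or3P[]/eqP->.
rewrite zeta_reE //; have zp := zeta_prim R m_gt0.
have x0 := zeta_neq0 R m_gt0; have zm := zeta_expn R m_gt0.
have nz k : (0 < k < m)%N -> zeta R m ^+ k != 1.
  move=> /andP[k0 km]; rewrite -(prim_order_dvd zp).
  by apply/negP => /dvdn_leq; lia.
move: (zeta R m) x0 zm nz => x x0 zm nz {zp}.
suff [c H] : exists c : int, x ^+ 2 + 1 = c%:~R * x.
  by exists c; apply: (mulIf x0); rewrite -H; field.
move: m346 zm nz; rewrite !inE => /or3P[]/eqP-> {m m_gt0} zm nz.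
- have := nz 1%N isT; rewrite expr1 -subr_eq0 => x1.
  exists (-1); apply/eqP; rewrite -subr_eq0 -(mulrI_eq0 _ (mulfI x1)).
  apply/eqP; transitivity (x ^+ 3 - 1); first by ring.
  by rewrite zm subrr.
- have := nz 2%N isT; rewrite -subr_eq0 => x1.
  exists 0; apply/eqP; rewrite -subr_eq0 -(mulrI_eq0 _ (mulfI x1)).
  apply/eqP; transitivity (x ^+ 4 - 1); first by ring.
  by rewrite zm subrr.
- have := nz 3%N isT; rewrite -subr_eq0 => x1.
  have := nz 2%N isT; rewrite -subr_eq0 => x2.
  exists 1; apply/eqP; rewrite -subr_eq0 -(mulrI_eq0 _ (mulfI x1)).
  rewrite -(mulrI_eq0 _ (mulfI x2)).
  apply/eqP; transitivity ((x ^+ 6 - 1) * (x - 1)); first by ring.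
  by rewrite zm subrr mul0r.
Qed.

End Inclusions.

(** * Ratios of parallel chords in a regular polygon *)

Section Plane.
Variable R : realType.
Implicit Types (u v w z a b c : R[i]) (r : R).

Definition complex_of (p : 'cV[R]_2) : R[i] := Complex (p 0 0) (p 1 0).

Lemma complex_ofK : cancel complex_of (@plane_of R).
Proof.
move=> p; apply/matrixP => i j; rewrite mxE ord1.
by case: i => -[|[|]] //= i2; congr (p _ _); apply: val_inj.
Qed.

Lemma plane_ofK : cancel (@plane_of R) complex_of.
Proof. by case=> a b; rewrite /complex_of !mxE. Qed.

Lemma plane_ofD u v : plane_of (u + v) = plane_of u + plane_of v.
Proof.
case: u v => [a b] [c d]; apply/matrixP => i j; rewrite !mxE /=.
by case: ifP.
Qed.

Lemma plane_ofN u : plane_of (- u) = - plane_of u.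
Proof.
by case: u => [a b]; apply/matrixP => i j; rewrite !mxE /=; case: ifP.
Qed.

Lemma plane_ofB u v : plane_of (u - v) = plane_of u - plane_of v.
Proof. by rewrite plane_ofD plane_ofN. Qed.

Lemma plane_of0 : plane_of 0 = 0 :> 'cV[R]_2.
Proof. by rewrite -(subrr 0) plane_ofB subrr. Qed.

Lemma plane_ofZ r u : plane_of (Complex r 0 * u) = r *: plane_of u.
Proof.
case: u => [a b]; apply/matrixP => i j; rewrite !mxE /=.
by case: ifP; rewrite mul0r ?subr0 ?addr0.
Qed.

Lemma orient_plane a b c :
  orient (plane_of a) (plane_of b) (plane_of c) =
  complex.Im (conjc (b - a) * (c - a)).
Proof.
by case: a b c => [a1 a2] [b1 b2] [c1 c2]; rewrite /orient !mxE /=; ring.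
Qed.

Lemma dot_plane u v : dot (plane_of u) (plane_of v) = complex.Re (conjc u * v).
Proof.
case: u v => [u1 u2] [v1 v2]; rewrite /dot !mxE big_ord_recl big_ord1 !mxE /=.
ring.
Qed.

(** Lagrange's identity: squared dot product plus squared cross product. *)
Lemma sqr_Re_Im_conjM u v :
  complex.Re (conjc u * v) ^+ 2 + complex.Im (conjc u * v) ^+ 2 =
  complex.Re (conjc u * u) * complex.Re (conjc v * v).
Proof. by case: u v => [u1 u2] [v1 v2] /=; ring. Qed.

Lemma Re_conjM_ge0 u : 0 <= complex.Re (conjc u * u).
Proof. by case: u => [u1 u2] /=; nra. Qed.

Lemma conjM_Re u : conjc u * u = Complex (complex.Re (conjc u * u)) 0.
Proof. by case: u => [u1 u2] /=; congr Complex => /=; ring. Qed.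

Lemma complex_one_addJ u :
  Complex (1 + 2 * complex.Re u) 0 = 1 + u + conjc u.
Proof.
case: u => a b; apply/eqP; rewrite eq_complex /=.
by apply/andP; split; apply/eqP; ring.
Qed.

End Plane.

Section CyclicOrdinals.
Variables (m : nat) (i0 : 'I_m).

Lemma val_iter_ordS k : iter k (@ordS m) i0 = ((i0 + k) %% m)%N :> nat.
Proof.
elim: k => [|k IH]; first by rewrite addn0 modn_small.
by rewrite addnS -[X in _ = (X %% m)%N]addn1 -modnDml -IH addn1.
Qed.

Lemma eq_iter_ordS j k :
  (iter j (@ordS m) i0 == iter k (@ordS m) i0) = (j == k %[mod m])%N.
Proof. by rewrite -val_eqE /= !val_iter_ordS eqn_modDl. Qed.

End CyclicOrdinals.

(** The vertices are indexed by all natural numbers, with period [m].  Besides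
    the points [P], [e] are the side vectors, [S] their squared lengths, and [X]
    and [C] the cross and dot products of consecutive side vectors. *)
Section RegularPolygon.
Variables (R : realType) (m : nat) (p : 'I_m -> 'cV[R]_2) (i0 : 'I_m).
Hypotheses (m_gt2 : (2 < m)%N) (pr : regular_polygon p).

Let V k := iter k (@ordS m) i0.
Let P k : R[i] := complex_of (p (V k)).
Let e k := P k.+1 - P k.
Let X k := complex.Im (conjc (e k) * e k.+1).

Let pE k : p (V k) = plane_of (P k).
Proof. by rewrite complex_ofK. Qed.

Let eE k : p (V k.+1) - p (V k) = plane_of (e k).
Proof. by rewrite !pE plane_ofB. Qed.

Let V_period k : V (k + m) = V k.
Proof. by apply/eqP; rewrite eq_iter_ordS modnDr. Qed.

Let V_notin j k : (k.+1 < j < k + m)%N -> V j \notin [:: V k; ordS (V k)].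
Proof.
move=> jk; rewrite -[ordS _]/(V k.+1) !inE !eq_iter_ordS.
apply/norP; split; rewrite eqn_mod_dvd; try lia.
  by apply/negP => /dvdn_leq; lia.
by apply/negP => /dvdn_leq; lia.
Qed.

(** Convexity at the side from [V k.+1] to [V k.+2] puts the vertices [V k] and
    [V k.+3] on the same side of it: the polygon always turns in the same
    direction. *)
Let X_sign k : 0 < X k * X k.+1.
Proof.
have [cvx _ _] := pr.
(* [V k] is written [V (k + m)] to make [V_notin] applicable *)
have := cvx (V k.+1) (V (k + m)) (V k.+3) (V_notin _) (V_notin _).
rewrite V_period -[ordS _]/(V k.+2) !pE !orient_plane.
have -> : complex.Im (conjc (P k.+2 - P k.+1) * (P k - P k.+1)) = X k.
  rewrite /X /e; case: (P k) (P k.+1) (P k.+2) => [? ?] [? ?] [? ?] /=; ring.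
have -> : complex.Im (conjc (P k.+2 - P k.+1) * (P k.+3 - P k.+1)) = X k.+1.
  rewrite /X /e; case: (P k.+3) (P k.+1) (P k.+2) => [? ?] [? ?] [? ?] /=.
  ring.
apply; lia.
Qed.

Let S k := complex.Re (conjc (e k) * e k).

Let S_const k : S k = S 0%N.
Proof.
have [_ sl _] := pr; have := sl (V k) (V 0%N); rewrite /side_length.
rewrite -[ordS (V k)]/(V k.+1) -[ordS (V 0)]/(V 1) !eE /enorm !dot_plane.
by move=> /(congr1 (fun x => x ^+ 2)); rewrite !sqr_sqrtr ?Re_conjM_ge0.
Qed.

Let C k := complex.Re (conjc (e k) * e k.+1).

Let C2DX2 k : C k ^+ 2 + X k ^+ 2 = S 0 ^+ 2.
Proof. by rewrite sqr_Re_Im_conjM -/(S k) -/(S k.+1) !S_const. Qed.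

Let S_gt0 : 0 < S 0.
Proof.
rewrite lt_neqAle Re_conjM_ge0 andbT eq_sym; apply/eqP => S0.
have /eqP := C2DX2 0; rewrite S0 expr0n /= paddr_eq0 ?sqr_ge0 // !sqrf_eq0.
by move=> /andP[_ /eqP X0]; have := X_sign 0; rewrite X0 mul0r ltxx.
Qed.

Let interior_angleE k : interior_angle p (V k.+1) = acos (- C k / S 0).
Proof.
rewrite /interior_angle /angle /enorm -[V k.+1]/(ordS (V k)) ordSK.
rewrite -[ordS (V k)]/(V k.+1) -[ordS (V k.+1)]/(V k.+2).
rewrite -[p (V k) - _]opprB !eE -plane_ofN !dot_plane rmorphN.
rewrite mulrNN -/(S k) -/(S k.+1) !S_const -expr2 sqr_sqrtr ?ltW //.
by rewrite mulNr raddfN.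
Qed.

Let C_const k : C k = C 0.
Proof.
have itv j : - C j / S 0 \in `[(-1), 1].
  rewrite in_itv /= ler_pdivlMr // ler_pdivrMr //.
  by apply/andP; split; have := C2DX2 j; have := S_gt0; nra.
have [_ _ ang] := pr; have := ang (V k.+1) (V 1).
rewrite !interior_angleE => /(congr1 cos); rewrite !acosK //.
by move/(mulIf (invr_neq0 (lt0r_neq0 S_gt0)))/oppr_inj.
Qed.

(** The dot product and the lengths determine the square of the cross product,
    and [X_sign] its sign. *)
Let X_const k : X k = X 0.
Proof.
elim: k => // k <-; have /eqP : X k.+1 ^+ 2 = X k ^+ 2.
  apply: (@addrI _ (C 0 ^+ 2)).
  by rewrite -{1}(C_const k.+1) -(C_const k) !C2DX2.
rewrite eqf_sqr => /orP[/eqP//|/eqP XN]; have := X_sign k.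
by rewrite XN mulrN oppr_gt0 -expr2 ltNge sqr_ge0.
Qed.

Let w : R[i] := Complex (C 0 / S 0) (X 0 / S 0).

Let e_succ k : e k.+1 = w * e k.
Proof.
have ek0 : conjc (e k) != 0.
  rewrite conjc_eq0; apply/eqP => ek; have := S_gt0.
  by rewrite -(S_const k) /S ek mulr0 ltxx.
apply: (mulfI ek0); rewrite mulrCA conjM_Re -/(S k) S_const.
have -> : conjc (e k) * e k.+1 = Complex (C k) (X k).
  by rewrite /C /X; case: (_ * _).
rewrite C_const X_const /w; have S0 := lt0r_neq0 S_gt0.
by simpc; rewrite !divfK.
Qed.

Let eX k : e k = w ^+ k * e 0.
Proof. by elim: k => [|k IH]; rewrite ?mul1r // e_succ IH mulrA exprS. Qed.

Let e0_neq0 : e 0 != 0.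
Proof. by apply/eqP => e0; have := S_gt0; rewrite /S e0 mulr0 ltxx. Qed.

Let chordE k : (w - 1) * (P k - P 0) = (w ^+ k - 1) * e 0.
Proof.
elim: k => [|k IH]; first by rewrite !subrr mulr0 mul0r.
have -> : P k.+1 - P 0 = e k + (P k - P 0) by rewrite /e; ring.
by rewrite mulrDr IH eX exprS; ring.
Qed.

Let w_neq1 : w != 1.
Proof.
apply/eqP => w1; have := X_sign 0; rewrite {1}/X e_succ w1 mul1r conjM_Re.
by rewrite mul0r ltxx.
Qed.

(** If [w] had a smaller order [d], the vertices [V d] and [V 0] would coincide,
    against convexity at the side from [V 0] to [V 1]. *)
Let w_prim : m.-primitive_root w.
Proof.
have wm : w ^+ m = 1.
  apply: (mulIf e0_neq0); rewrite -eX mul1r /e /P.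
  by rewrite -[V m]/(V (0 + m)) -[V m.+1]/(V (1 + m)) !V_period.
have m_gt0 : (0 < m)%N by lia.
have [d wd dm] := prim_order_exists m_gt0 wm.
suff <- : d = m by [].
have d_gt0 := prim_order_gt0 wd; have d_le := dvdn_leq m_gt0 dm.
apply/eqP; rewrite eqn_leq d_le leqNgt; apply/negP => dlt.
have d_gt1 : (1 < d)%N.
  rewrite ltn_neqAle d_gt0 andbT; apply/eqP => d1; move: w_neq1.
  by rewrite -[w]expr1 d1 (prim_expr_order wd) eqxx.
have Pd : P d = P 0.
  have := chordE d; rewrite (prim_expr_order wd) subrr mul0r => /eqP.
  by rewrite mulf_eq0 !subr_eq0 (negPf w_neq1) => /eqP.
have [cvx _ _] := pr.
have Vd : V d \notin [:: V 0; ordS (V 0)] by apply: V_notin; lia.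
have := cvx _ _ _ Vd Vd; rewrite -[ordS _]/(V 1) !pE Pd orient_plane.
by rewrite subrr mulr0 mul0r ltxx.
Qed.

(** The chord from vertex 0 to vertex 3 is the sum of the side vectors
    [w^-1 * e 1], [e 1] and [w * e 1]. *)
Lemma regular_polygon_root : exists (w : R[i]) (r : R),
  [/\ m.-primitive_root w, Complex r 0 = 1 + w + w^-1,
      p (iter 3 (@ordS m) i0) - p i0 =
        r *: (p (iter 2 (@ordS m) i0) - p (iter 1 (@ordS m) i0)) &
      p (iter 2 (@ordS m) i0) != p (iter 1 (@ordS m) i0)].
Proof.
have m_gt0 : (0 < m)%N by lia.
have w0 := unity_neq0 m_gt0 (prim_expr_order w_prim).
have rE : Complex (1 + 2 * complex.Re w) 0 = 1 + w + w^-1.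
  rewrite -(conjc_unity m_gt0 (prim_expr_order w_prim)).
  exact: complex_one_addJ.
have P30 : P 3 - P 0 = (1 + w + w^-1) * (P 2 - P 1).
  have -> : P 3 - P 0 = e 2 + e 1 + e 0 by rewrite /e; ring.
  by rewrite -/(e 1) (eX 2) (eX 1); field.
exists w, (1 + 2 * complex.Re w); split.
- exact: w_prim.
- exact: rE.
- by rewrite -[i0]/(V 0) -!/(V _) eE -plane_ofZ rE !pE -plane_ofB P30.
rewrite -!/(V _) -subr_eq0 eE -plane_of0 (can_eq (@plane_ofK R)) eX.
rewrite mulf_eq0 (negPf e0_neq0) orbF expr1.
by rewrite (negPf w0).
Qed.

End RegularPolygon.

Lemma affinely_regular_unity (R : realType) (m : nat) (v : 'I_m -> 'cV[R]_2)
    (t : 'cV[R]_2) (z : 'I_m -> R[i]) :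
  (2 < m)%N -> affinely_regular v -> (forall i, v i = t + plane_of (z i)) ->
  exists (w : R[i]) (i0 i1 i2 i3 : 'I_m), [/\ m.-primitive_root w,
    z i2 != z i1 & z i3 - z i0 = (1 + w + w^-1) * (z i2 - z i1)].
Proof.
move=> m_gt2 [p [A [s [pr A0 vE]]]] vz.
have i0 : 'I_m by apply: (@Ordinal m 0); lia.
have [w [r [wm rE p30 p21]]] := regular_polygon_root i0 m_gt2 pr.
exists w, i0.
exists (iter 1 (@ordS m) i0), (iter 2 (@ordS m) i0), (iter 3 (@ordS m) i0).
move: (iter 1 _ _) (iter 2 _ _) (iter 3 _ _) p30 p21 => i1 i2 i3 p30 p21.
have vB i j : plane_of (z i - z j) = A *m (p i - p j).
  rewrite plane_ofB mulmxBr; transitivity (v i - v j).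
    by rewrite !vz opprD addrACA subrr add0r.
  by rewrite !vE opprD addrACA subrr addr0.
have z30 : z i3 - z i0 = (1 + w + w^-1) * (z i2 - z i1).
  apply: (can_inj (@plane_ofK R)).
  by rewrite -rE plane_ofZ !vB p30 scalemxAr.
split=> //; rewrite -subr_eq0.
  apply: contra_neq p21 => z0; apply/eqP; rewrite -subr_eq0; apply/eqP.
  have Au : A \in unitmx by rewrite unitmxE unitfE.
  by rewrite -(mulKmx Au (p i2 - p i1)) -vB z0 plane_of0 mulmx0.
Qed.

(** The root [w] may be any primitive [m]-th root of unity; since [zeta_m] is a
    power of it, [symmetric_power] recovers [zeta_re R m] from [w + w^-1]. *)
Lemma affinely_regular_KK (R : realType) (m n : nat) (v : 'I_m -> 'cV[R]_2)
    (t : 'cV[R]_2) (z : 'I_m -> R[i]) :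
  (2 < m)%N -> affinely_regular v -> (forall i, v i = t + plane_of (z i)) ->
  (forall i, OO R n (z i)) -> KK R n (zeta_re R m).
Proof.
move=> m_gt2 vr vz zO; have m_gt0 : (0 < m)%N by lia.
have [w [i0 [i1 [i2 [i3 [wm z21 z30]]]]]] := affinely_regular_unity m_gt2 vr vz.
have /= [k zk] := prim_rootP wm (zeta_expn R m_gt0).
have w0 := unity_neq0 m_gt0 (prim_expr_order wm).
rewrite zeta_reE // zk.
have : KK R n (w + w^-1).
  have -> : w + w^-1 = ((z i3 - z i0) - (z i2 - z i1)) / (z i2 - z i1).
    by rewrite z30; field; rewrite w0 subr_eq0 z21.
  apply: field_gen_div; apply: ring_field_gen; do ?apply: ring_genB;
    exact: zO.
move=> /field_gen_trans; apply; apply: ring_field_gen.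
exact: symmetric_power.
Qed.

(** * Affinely regular polygons with vertices in Z[zeta_n] *)

Lemma det_mx2 (F : comNzRingType) (A : 'M[F]_2) :
  \det A = A 0 0 * A 1 1 - A 0 1 * A 1 0.
Proof.
rewrite (expand_det_row _ 0) !big_ord_recl big_ord0 /cofactor !det_mx11 !mxE /=.
rewrite expr0 expr1 addr0 mul1r mulN1r mulrN.
by congr (_ * A _ _ - A _ _ * A _ _); apply: val_inj.
Qed.

Section AffineImages.
Variables (R : realType) (m : nat).
Implicit Types (p v : 'I_m -> 'cV[R]_2) (A : 'M[R]_2) (t : 'cV[R]_2).

Lemma orient_affine A t a b c :
  orient (A *m a + t) (A *m b + t) (A *m c + t) = \det A * orient a b c.
Proof.
have o1 : lift ord0 ord0 = 1 :> 'I_2 by apply: val_inj.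
have o0 : ord0 = 0 :> 'I_2 by apply: val_inj.
rewrite /orient det_mx2 !mxE !big_ord_recl !big_ord0 o1 o0.
ring.
Qed.

Lemma affinely_regular_convex v : affinely_regular v -> convex_polygon v.
Proof.
move=> [p [A [t [[cvx _ _] A0 vE]]]] i j k ji ki.
rewrite !vE !orient_affine mulrACA -expr2 mulr_gt0 //; last exact: cvx.
by rewrite exprn_even_gt0.
Qed.

Lemma affinely_regular_affine v A t : affinely_regular v -> \det A != 0 ->
  affinely_regular (fun i => A *m v i + t).
Proof.
move=> [p [B [s [pr B0 vE]]]] A0; exists p, (A *m B), (A *m s + t); split=> //.
  by rewrite det_mulmx mulf_neq0.
by move=> i; rewrite vE mulmxDr mulmxA addrA.
Qed.

End AffineImages.

Section LinearMaps.
Variable R : realType.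
Implicit Types (x y z : R[i]).

(** The real linear map which sends 1 to [x] and the imaginary unit to [y]. *)
Definition basis_mx x y : 'M[R]_2 :=
  \matrix_(i < 2, j < 2) plane_of (if j == 0 then x else y) i 0.

Lemma mul_basis_mx x y z : basis_mx x y *m plane_of z =
  plane_of (Complex (complex.Re z) 0 * x + Complex (complex.Im z) 0 * y).
Proof.
rewrite plane_ofD !plane_ofZ; apply/matrixP => i j.
rewrite !mxE big_ord_recl big_ord1 !mxE /=.
by rewrite [complex.Re z * _]mulrC [complex.Im z * _]mulrC.
Qed.

Lemma det_basis_mx x y : \det (basis_mx x y) = complex.Im (conjc x * y).
Proof.
by case: x y => [a b] [c d]; rewrite det_mx2 !mxE /=; ring.
Qed.

Lemma complex_mulE x z :
  Complex (complex.Re z) 0 * x + Complex (complex.Im z) 0 * (x * Complex 0 1) =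
  x * z.
Proof.
case: x z => [a b] [c d]; apply/eqP; rewrite eq_complex /=.
by apply/andP; split; apply/eqP; ring.
Qed.

End LinearMaps.

Section UnitPolygon.
Variables (R : realType) (m : nat).
Hypothesis m_gt2 : (2 < m)%N.
Let z := zeta R m.
Let v (i : 'I_m) := plane_of (z ^+ i).

(** The factorization shows the sign of the orientation of three points of the
    unit circle; the doubled angles make the right-hand side polynomial in the
    sines and cosines of [a], [b] and [c]. *)
Lemma orient_cis (a b c : R) :
  orient (plane_of (cis (2 * a))) (plane_of (cis (2 * b)))
    (plane_of (cis (2 * c))) = 4 * (sin (b - a) * (sin (c - b) * sin (c - a))).
Proof.
have H (x : R) : cos x ^+ 2 + sin x ^+ 2 = 1 := cos2Dsin2 x.
have cisE (x : R) :
    cis (2 * x) = Complex (cos x ^+ 2 - sin x ^+ 2) (2 * (sin x * cos x)).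
  rewrite /cis !mulr_natl cos_mulr2n sin_mulr2n -(H x); congr Complex; ring.
rewrite orient_plane !cisE !sinB /=.
move: (H a) (H b) (H c).
move: (cos a) (sin a) (cos b) (sin b) (cos c) (sin c).
move=> ca sa cb sb cc sc Ha Hb Hc.
pose cr x y x' y' : R := (x ^+ 2 - y ^+ 2) * (2 * (y' * x')) -
  2 * (y * x) * (x' ^+ 2 - y' ^+ 2).
(* multiplying by sums of squares equal to 1 makes both sides homogeneous *)
transitivity (cr ca sa cb sb * (cc ^+ 2 + sc ^+ 2) +
  cr cb sb cc sc * (ca ^+ 2 + sa ^+ 2) + cr cc sc ca sa * (cb ^+ 2 + sb ^+ 2)).
  by rewrite Ha Hb Hc /cr; ring.
by rewrite /cr; ring.
Qed.

Let m_gt0 : (0 < m)%N.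
Proof. lia. Qed.

Let z_neq0 : z != 0 := zeta_neq0 R m_gt0.

Let z_ordS (i : 'I_m) : z ^+ ordS i = z ^+ i * z.
Proof. by rewrite /= (prim_expr_mod (zeta_prim R m_gt0)) exprSr. Qed.

Let z_ord_pred (i : 'I_m) : z ^+ ord_pred i = z ^+ i * z^-1.
Proof. by rewrite -[in RHS](ord_predK i) z_ordS mulfK. Qed.

(** Rotations preserve dot products; hence all sides and all angles agree. *)
Let dot_rotate k x y :
  dot (plane_of (z ^+ k * x)) (plane_of (z ^+ k * y)) =
  dot (plane_of x) (plane_of y).
Proof.
have zc : conjc z = z^-1 := conjc_unity m_gt0 (zeta_expn R m_gt0).
rewrite !dot_plane; have -> : conjc (z ^+ k * x) = z^-1 ^+ k * conjc x.
  by rewrite -zc -rmorphXn -rmorphM.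
by rewrite mulrACA exprVn mulVf ?expf_neq0 // mul1r.
Qed.

Let v_pred (i : 'I_m) : v (ord_pred i) - v i = plane_of (z ^+ i * (z^-1 - 1)).
Proof. by rewrite -plane_ofB z_ord_pred mulrBr mulr1. Qed.

Let v_succ (i : 'I_m) : v (ordS i) - v i = plane_of (z ^+ i * (z - 1)).
Proof. by rewrite -plane_ofB z_ordS mulrBr mulr1. Qed.

Lemma zeta_polygon_regular : regular_polygon v.
Proof.
have pos (i j : 'I_m) : j \notin [:: i; ordS i] ->
    0 < orient (v i) (v (ordS i)) (v j).
  rewrite !inE negb_or -!val_eqE /= => /andP[ji jSi].
  rewrite /v z_ordS -exprSr !zetaX orient_cis.
  pose a : R := pi / m%:R.
  have sub x y : pi * x%:R / m%:R - pi * y%:R / m%:R = a * (x%:R - y%:R).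
    by rewrite /a; field; rewrite pnatr_eq0 -lt0n.
  have a_gt0 : 0 < a by rewrite divr_gt0 ?pi_gt0 ?ltr0n.
  have sin_pos (x : nat) : (0 < x < m)%N -> 0 < sin (a * x%:R).
    move=> /andP[x0 xm]; apply: sin_gt0_pi; rewrite mulr_gt0 ?ltr0n //=.
    by rewrite /a mulrAC ltr_pdivrMr ?ltr0n // ltr_pM2l ?pi_gt0 // ltr_nat.
  rewrite !sub mulr_gt0 // mulr_gt0 //.
    by rewrite -natrB // subSnn; apply: sin_pos; lia.
  have jm := ltn_ord j; have im := ltn_ord i.
  have [ij|ij] := ltnP i j.
    have iSm : (i.+1 < m)%N by lia.
    rewrite (modn_small iSm) in jSi.
    by rewrite -!natrB; try lia; rewrite mulr_gt0 //; apply: sin_pos; lia.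
  rewrite -[_ - i.+1%:R]opprB -[_ - i%:R]opprB !mulrN !sinN mulrNN.
  rewrite -!natrB; try lia; rewrite mulr_gt0 //; apply: sin_pos; last by lia.
  suff : (i.+1 - j)%N != m by lia.
  apply: contra jSi => /eqP ijm.
  have iSm : i.+1 = m by lia.
  rewrite iSm modnn; lia.
split.
- by move=> i j k ji ki; rewrite mulr_gt0 // pos.
- by move=> i j; rewrite /side_length /enorm !v_succ !dot_rotate.
- move=> i j; rewrite /interior_angle /angle /enorm.
  by rewrite !v_succ !v_pred !dot_rotate.
Qed.

End UnitPolygon.

(** If [zeta_re R m] is an integer [c], the powers of [zeta_m] satisfy the
    recurrence [z^(k+2) = c * z^(k+1) - z^k].  The real linear map [B] below,
    with [B 1 = 1] and [B zeta_m = zeta_n], preserves it, so it maps all the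
    powers into [OO R n]. *)
Lemma affinely_regular_in_OO (R : realType) m n : (2 < m)%N -> (2 < n)%N ->
  m \in [:: 3; 4; 6]%N \/ OO R n (zeta R m) ->
  exists b : 'I_m -> R[i],
    (forall i, OO R n (b i)) /\ affinely_regular (fun i => plane_of (b i)).
Proof.
move=> m_gt2 n_gt2 H; have preg := zeta_polygon_regular R m_gt2.
have zreg : affinely_regular (fun i : 'I_m => plane_of (zeta R m ^+ i)).
  exists (fun i : 'I_m => plane_of (zeta R m ^+ i)), 1, 0; split=> //.
    by rewrite det1 oner_neq0.
  by move=> i; rewrite mul1mx addr0.
case: H => [m346|mO]; last first.
  by exists (fun i : 'I_m => zeta R m ^+ i); split=> // i; apply: ring_genX.
have [c zc] := zeta_re_int R m346.
have Im_neq0 k : (2 < k)%N -> complex.Im (zeta R k) != 0.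
  move=> /(conjc_zeta_neq R); case: (zeta R k) => x y /=.
  by apply: contra_neq => ->; rewrite oppr0.
have [Imm Imn] := (Im_neq0 m m_gt2, Im_neq0 n n_gt2).
set x := complex.Re (zeta R m); set y := complex.Im (zeta R m) in Imm.
pose s : R -> R[i] := real_complex R.
have sE r : s r = Complex r 0 by [].
have y0 : s y != 0 by rewrite fmorph_eq0.
(* the image of the imaginary unit under [B] *)
pose tau := (zeta R n - s x) / s y.
pose B u := s (complex.Re u) + s (complex.Im u) * tau.
have BE u : plane_of (B u) = basis_mx 1 tau *m plane_of u + 0.
  by rewrite mul_basis_mx mulr1 addr0.
have Blin r u w : B (s r * u - w) = s r * B u - B w.
  rewrite /B; case: u w => [u1 u2] [w1 w2].
  have -> : s r * Complex u1 u2 - Complex w1 w2 =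
      Complex (r * u1 - w1) (r * u2 - w2).
    by apply/eqP; rewrite eq_complex /=; apply/andP; split; apply/eqP; ring.
  by rewrite /= /s !rmorphB !rmorphM /=; ring.
have cE : c%:~R = s c%:~R := esym (rmorph_int (real_complex R) c).
exists (fun i : 'I_m => B (zeta R m ^+ i)); split.
  move=> i; move: (val i) => k; suff [] : OO R n (B (zeta R m ^+ k)) /\
      OO R n (B (zeta R m ^+ k.+1)) by [].
  elim: k => [|k [IH1 IH2]]; split=> //.
  - by rewrite /B expr0 /s rmorph1 rmorph0 mul0r addr0; exact: (ring_gen_int 1).
  - rewrite expr1 /B -/x -/y.
    have -> : s x + s y * tau = zeta R n by rewrite /tau; field.
    exact: ring_gen_gen.
  have -> : zeta R m ^+ k.+2 = s c%:~R * zeta R m ^+ k.+1 - zeta R m ^+ k.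
    rewrite -cE -zc zeta_reE; last by lia.
    by rewrite !exprS; field; apply: zeta_neq0; lia.
  rewrite Blin -cE; apply: ring_genB => //; apply: ring_genM => //.
  exact: ring_gen_int.
have -> : (fun i : 'I_m => plane_of (B (zeta R m ^+ i))) =
    (fun i : 'I_m => basis_mx 1 tau *m plane_of (zeta R m ^+ i) + 0).
  by apply/funext => i; exact: BE.
apply: affinely_regular_affine => //.
rewrite det_basis_mx rmorph1 mul1r /tau.
have -> : complex.Im ((zeta R n - s x) / s y) = complex.Im (zeta R n) / y.
  rewrite -[s y]/(s y) -fmorphV /=; case: (zeta R n) => a b.
  by rewrite /s /=; ring.
by rewrite mulf_neq0 // invr_neq0.
Qed.

(** * Diophantine approximation and real interpolation *)

(** Dirichlet's box principle.  For coefficients below [M] the vectors of values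
    lie in a cube whose side is proportional to [M]; with boxes of side [eps]
    there are about [M ^ #|T|] boxes for [M ^ N] coefficient vectors.  Two
    coefficient vectors in the same box have the required difference. *)
Lemma dirichlet_simultaneous (R : archiRealFieldType) (T : finType) N
    (a : T -> 'I_N -> R) (eps : R) : (#|T| < N)%N -> 0 < eps ->
  exists x : 'I_N -> int, (exists j, x j != 0) /\
    forall t, `|\sum_j a t j * (x j)%:~R| < eps.
Proof.
move=> TN eps_gt0.
pose A := \sum_t \sum_j `|a t j|.
have aA t : \sum_j `|a t j| <= A.
  rewrite /A (bigD1 t) //= lerDl sumr_ge0 // => u _; exact: sumr_ge0.
have A_ge0 : 0 <= A by apply: sumr_ge0 => t _; apply: sumr_ge0.
(* [D * M] boxes of side [eps] cover an interval of length [2 * A * M] *)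
pose D := (Num.bound (2 * A / eps)).+1.
have AD : 2 * A < D%:R * eps.
  rewrite -ltr_pdivrMr //; apply: lt_le_trans (_ : D.-1%:R <= _).
    by apply: archi_boundP; rewrite divr_ge0 ?mulr_ge0 // ltW.
  by rewrite ler_nat.
(* chosen so that [(D * M) ^ p < M ^ p.+1] *)
pose p := #|T|; pose M := (D ^ p).+1.
pose F (c : {ffun 'I_N -> 'I_M}) t := \sum_j a t j * (c j)%:R.
have FB c t : `|F c t| <= A * M%:R.
  apply: le_trans (ler_norm_sum _ _ _) _.
  apply: le_trans (_ : \sum_j `|a t j| * M%:R <= _).
    apply: ler_sum => j _; rewrite normrM ler_wpM2l // normr_nat ler_nat.
    exact/ltnW/ltn_ord.
  by rewrite -mulr_suml ler_wpM2r.
pose g c t := (F c t + A * M%:R) / eps.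
have g_ge0 c t : 0 <= g c t.
  apply: divr_ge0; last exact: ltW.
  by have := FB c t; rewrite ler_norml -subr_ge0 opprK => /andP[].
have gB c t : (Num.truncn (g c t) < D * M)%N.
  rewrite truncn_lt_nat //.
  rewrite ltr_pdivrMr // natrM mulrAC.
  apply: le_lt_trans (_ : 2 * A * M%:R < _); last by rewrite ltr_pM2r // ltr0n.
  rewrite -mulrA [2 * _]mulr_natl mulr2n lerD2r.
  by have := FB c t; rewrite ler_norml => /andP[].
pose G c : {ffun T -> 'I_(D * M)} := [ffun t => Ordinal (gB c t)].
have [c [c' [cc' Gcc']]] : exists c c', c != c' /\ G c = G c'.
  apply: contrapT => H; have : injective G.
    move=> c c' Gcc'; apply/eqP; apply: contrapT => /negP cc'; apply: H.
    by exists c, c'.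
  move=> /leq_card; rewrite !card_ffun !card_ord expnMn leqNgt => /negP[].
  apply: leq_trans (_ : M * M ^ p <= _)%N.
    by rewrite ltn_pmul2r ?expn_gt0.
  by rewrite -expnS leq_exp2l // /M; rewrite /M ltnS expn_gt0.
exists (fun j => (c j)%:Z - (c' j)%:Z); split.
  have /existsP[j cj] : [exists j, c j != c' j].
    apply: contraNT cc' => /existsPn H; apply/eqP/ffunP => j.
    by apply/eqP; rewrite -[_ == _]negbK.
  exists j; rewrite subr_eq0 eqz_nat; exact: cj.
move=> t; have -> : \sum_j a t j * ((c j)%:Z - (c' j)%:Z)%:~R = F c t - F c' t.
  by rewrite /F -sumrB; apply: eq_bigr => j _; rewrite rmorphB /= mulrBr.
have /(congr1 (fun h : {ffun T -> 'I_(D * M)} => val (h t))) := Gcc'.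
rewrite !ffunE /= => gg.
have := truncn_itv (g_ge0 c t); have := truncn_itv (g_ge0 c' t); rewrite gg.
set q := Num.truncn _ => /andP[l1 u1] /andP[l2 u2].
have FE d : F d t = g d t * eps - A * M%:R by rewrite /g divfK ?gt_eqF // addrK.
have -> : F c t - F c' t = (g c t - g c' t) * eps by rewrite !FE; ring.
rewrite normrM (gtr0_norm eps_gt0) gtr_pMl // ltr_norml.
rewrite -natr1 in u1 u2.
by apply/andP; split; lra.
Qed.

Section NormC.
Variable R : rcfType.
Implicit Types (z w : R[i]).

Lemma Re_le_normc z : `|complex.Re z| <= normc z.
Proof.
by case: z => a b /=; rewrite -sqrtr_sqr ler_wsqrtr // lerDl sqr_ge0.
Qed.

Lemma Im_le_normc z : `|complex.Im z| <= normc z.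
Proof.
by case: z => a b /=; rewrite -sqrtr_sqr ler_wsqrtr // lerDr sqr_ge0.
Qed.

Lemma normc_le_ReIm z : normc z <= `|complex.Re z| + `|complex.Im z|.
Proof.
case: z => a b /=.
have -> : `|a| + `|b| = Num.sqrt ((`|a| + `|b|) ^+ 2).
  by rewrite sqrtr_sqr [RHS]ger0_norm ?addr_ge0.
apply: ler_wsqrtr.
rewrite sqrrD !real_normK ?num_real // -addrA lerD2l lerDr.
by rewrite mulrn_wge0 // mulr_ge0.
Qed.

Lemma normc_ge0 z : 0 <= normc z.
Proof. by case: z => a b; exact: sqrtr_ge0. Qed.

Lemma normcX z k : normc (z ^+ k) = normc z ^+ k.
Proof. by elim: k => [|k IH]; rewrite ?expr0 ?normc1 // !exprS normcM IH. Qed.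

Lemma normc_real (r : R) : normc (real_complex R r) = `|r|.
Proof. by rewrite /= expr0n addr0 sqrtr_sqr. Qed.

Lemma normc_sum (I : Type) (s : seq I) (F : I -> R[i]) :
  normc (\sum_(i <- s) F i) <= \sum_(i <- s) normc (F i).
Proof.
elim/big_ind2: _ => [|x y u w xy uw|//]; first by rewrite normc0.
exact: le_trans (le_normcD _ _) (lerD xy uw).
Qed.

Lemma normc_unity w n : (0 < n)%N -> w ^+ n = 1 -> normc w = 1.
Proof.
move=> n_gt0 wn; apply/eqP; rewrite -(pexpr_eq1 n_gt0) ?normc_ge0 //.
by rewrite -normcX wn normc1.
Qed.

End NormC.

Section Interpolation.
Variable R : rcfType.
Implicit Types (s : seq R[i]) (w z : R[i]) (P Q : {poly R}).

Definition evalR w P : R[i] := (map_poly (real_complex R) P).[w].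

(** A product of the real quadratic polynomials with the roots [z] and
    [conjc z]. *)
Lemma real_poly_vanishing s w : w \notin s -> conjc w \notin s ->
  exists Q, [/\ (size Q <= (2 * size s).+1)%N,
    {in s, forall z, evalR z Q = 0} & evalR w Q != 0].
Proof.
elim: s => [|z s IH].
  move=> _ _; exists 1; rewrite size_poly1; split=> //.
  by rewrite /evalR rmorph1 hornerC oner_neq0.
rewrite !inE !negb_or => /andP[wz ws] /andP[cwz cws].
have [Q [Qsize Qs Qw]] := IH ws cws.
pose q : {poly R} := 'X ^+ 2 - (2 * complex.Re z) *: 'X +
   (complex.Re z ^+ 2 + complex.Im z ^+ 2)%:P.
have qE u : evalR u q = (u - z) * (u - conjc z).
  have evq t d : evalR u ('X ^+ 2 - t *: 'X + d%:P) =
      u * u - real_complex R t * u + real_complex R d.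
    rewrite /evalR rmorphD rmorphB /= rmorphXn /= map_polyZ map_polyX map_polyC.
    by rewrite hornerD hornerD hornerN hornerXn hornerZ hornerX hornerC expr2.
  rewrite /q evq; case: z u {wz cwz q evq} => [a b] [c d].
  by apply/eqP; rewrite eq_complex /=; apply/andP; split; apply/eqP; ring.
exists (q * Q); split.
- apply: leq_trans (size_polyMleq _ _) _.
  have : (size q <= 3)%N.
    rewrite /q (leq_trans (size_polyD _ _)) // geq_max.
    rewrite (leq_trans (size_polyC_leq1 _)) // andbT.
    rewrite (leq_trans (size_polyD _ _)) // geq_max size_polyXn size_polyN.
    by rewrite (leq_trans (size_scale_leq _ _)) // size_polyX.
  move: Qsize => /=; lia.
- move=> u; rewrite /evalR rmorphM hornerM -![_.[_]]/(evalR _ _) qE.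
  by rewrite inE => /orP[/eqP->|/Qs->]; rewrite ?subrr ?mul0r ?mulr0.
- rewrite /evalR rmorphM hornerM -![_.[_]]/(evalR _ _) qE mulf_neq0 //.
  rewrite mulf_neq0 // subr_eq0 //.
  by apply: contra cwz => /eqP ->; rewrite conjcK.
Qed.

(** Newton interpolation, one node at a time.  The size bound depends only on
    the number of nodes; this keeps rounding errors uniform in the values [y]. *)
Lemma real_interpolation s (y : R[i] -> R[i]) :
  uniq s -> {in s &, forall z w, conjc z != w} ->
  exists P, (size P <= 2 * size s)%N /\ {in s, forall z, evalR z P = y z}.
Proof.
elim: s => [|w s IH]; first by exists 0; rewrite size_poly0.
rewrite cons_uniq => /andP[ws us] conj_s.
have [|P [Psize Ps]] := IH us.
  by move=> z u zs us'; apply: conj_s; rewrite inE ?zs ?us' orbT.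
have cws : conjc w \notin s.
  apply/negP => cws; have := conj_s w (conjc w).
  by rewrite !inE eqxx cws orbT => /(_ isT isT)/eqP.
have [Q [Qsize Qs Qw]] := real_poly_vanishing ws cws.
pose r := (y w - evalR w P) / evalR w Q.
have Imw : complex.Im w != 0.
  have := conj_s w w; rewrite inE eqxx => /(_ isT isT).
  by case: (w) => a b /=; apply: contra_neq => ->; rewrite oppr0.
(* the real linear polynomial with the value [r] at the non-real node [w] *)
pose b := complex.Im r / complex.Im w.
pose a := complex.Re r - b * complex.Re w.
pose l : {poly R} := a%:P + b *: 'X.
have lw : evalR w l = r.
  rewrite /evalR /l rmorphD /= map_polyZ map_polyX map_polyC !hornerE.
  rewrite /a /b; move: Imw; case: (r) (w) => [r1 r2] [w1 w2] /= w20.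
  by apply/eqP; rewrite eq_complex /=; apply/andP; split; apply/eqP; field.
have evE u : evalR u (P + l * Q) = evalR u P + evalR u l * evalR u Q.
  by rewrite /evalR rmorphD rmorphM hornerD hornerM.
exists (P + l * Q); split.
  rewrite (leq_trans (size_polyD _ _)) // geq_max /=; apply/andP; split.
    by apply: leq_trans Psize _; lia.
  apply: leq_trans (size_polyMleq _ _) _.
  have : (size l <= 2)%N.
    rewrite (leq_trans (size_polyD _ _)) // geq_max.
    rewrite (leq_trans (size_polyC_leq1 _)) //=.
    by rewrite (leq_trans (size_scale_leq _ _)) // size_polyX.
  move: Qsize; lia.
move=> u; rewrite evE inE => /orP[/eqP->|us'].
  by rewrite lw /r divfK // addrC subrK.
by rewrite Qs // mulr0 addr0 Ps.
Qed.

End Interpolation.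

(** * Moving a finite set into the window *)

Lemma evalZ_poly (F : numFieldType) (w : F) N (c : nat -> int) :
  evalZ w (\poly_(l < N) c l) = \sum_(l < N) (c l)%:~R * w ^+ l.
Proof.
rewrite /evalZ (@horner_coef_wide _ N) //; last first.
  exact: leq_trans (size_poly _ _) (size_poly _ _).
by apply: eq_bigr => l _; rewrite coef_map_id0 ?rmorph0 // coef_poly ltn_ord.
Qed.

Section Rounding.
Variable R : realType.

Lemma evalR_coef (w : R[i]) (P : {poly R}) :
  evalR w P = \sum_(l < size P) real_complex R P`_l * w ^+ l.
Proof.
rewrite /evalR (@horner_coef_wide _ (size P)) ?size_map_poly //.
by apply: eq_bigr => l _; rewrite coef_map.
Qed.

Lemma complex_sum (I : Type) (r : seq I) (F : I -> R[i]) (A B : I -> R) :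
  (forall i, F i = Complex (A i) (B i)) ->
  \sum_(i <- r) F i = Complex (\sum_(i <- r) A i) (\sum_(i <- r) B i).
Proof.
by move=> H; elim: r => [|i r IH]; rewrite ?big_nil // !big_cons IH H.
Qed.

(** Coefficients are rounded down, so each error is nonnegative and less
    than 1. *)
Lemma poly_rounding (P : {poly R}) : exists f : {poly int},
  forall w : R[i], normc w = 1 -> normc (evalR w P - evalZ w f) <= (size P)%:R.
Proof.
exists (\poly_(l < size P) Num.floor P`_l) => w w1.
rewrite evalR_coef evalZ_poly -sumrB; apply: le_trans (normc_sum _ _) _.
apply: le_trans (_ : \sum_(l < size P) 1 <= _); last first.
  by rewrite sumr_const card_ord.
apply: ler_sum => l _.
rewrite -(rmorph_int (real_complex R)) -mulrBl -rmorphB.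
rewrite normcM normcX w1 expr1n mulr1 normc_real.
have := floor_itv P`_l; rewrite intrD ler_norml; lra.
Qed.

Lemma real_interpolation_family (I : finType) (w : I -> R[i]) (y : I -> R[i]) :
  injective w -> (forall i j, conjc (w i) != w j) ->
  exists P : {poly R}, (size P <= 2 * #|I|)%N /\ forall i, evalR (w i) P = y i.
Proof.
move=> w_inj w_conj; pose s := [seq w i | i : I].
pose y' u := if [pick i | w i == u] is Some i then y i else 0.
have [||P [Psize Py]] := @real_interpolation _ s y'.
- by rewrite map_inj_uniq // enum_uniq.
- by move=> _ _ /mapP[i _ ->] /mapP[j _ ->].
exists P; split; first by rewrite size_image in Psize.
move=> i; rewrite Py; last by apply/mapP; exists i; rewrite ?mem_enum.
rewrite /y'; case: pickP => [j /eqP/w_inj->//|/(_ i)].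
by rewrite eqxx.
Qed.

End Rounding.

Section FieldHom.
Variables (R : realType) (n : nat).
Local Notation z := (zeta R n).

Definition field_hom (s : R[i] -> R[i]) : Prop :=
  [/\ {in KK R n &, {morph s : x y / x + y}},
      {in KK R n &, {morph s : x y / x * y}}
    & forall q : rat, s (ratr q) = ratr q].

Lemma in_Gal_field_hom s : in_Gal (KK R n) s -> field_hom s.
Proof.
move=> [_ sD sM sQ]; split=> // x y; rewrite !inE; [exact: sD | exact: sM].
Qed.

Lemma field_hom_conjc s : field_hom s -> field_hom (conjc \o s).
Proof.
move=> [sD sM sQ]; split.
- by move=> x y Kx Ky; rewrite /= sD // rmorphD.
- by move=> x y Kx Ky; rewrite /= sM // rmorphM.
- by move=> q; rewrite /= sQ fmorph_rat.
Qed.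

Lemma mem_evalZ f : evalZ z f \in KK R n.
Proof. by rewrite inE; apply: ring_field_gen; apply/ring_genP; exists f. Qed.

Lemma zeta_KK : z \in KK R n.
Proof. by rewrite -(evalZX z) mem_evalZ. Qed.

Lemma field_hom_evalZ s f : field_hom s -> s (evalZ z f) = evalZ (s z) f.
Proof.
move=> [sD sM sQ].
have s_int (c : int) : s c%:~R = c%:~R by have := sQ c%:~R; rewrite ratr_int.
elim/poly_ind: f => [|f c IH]; first by rewrite !evalZ0; exact: (s_int 0).
have -> : evalZ z (f * 'X + c%:P) = evalZ z f * z + evalZ z c%:P.
  by rewrite evalZD evalZM evalZX.
rewrite sD ?mem_evalZ //; last first.
  by have := mem_evalZ (f * 'X); rewrite evalZM evalZX.
rewrite sM ?mem_evalZ ?zeta_KK // IH evalZD evalZM evalZX !evalZC.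
by rewrite s_int.
Qed.

Lemma field_hom_neq0 s x : field_hom s -> x \in KK R n -> x != 0 -> s x != 0.
Proof.
move=> [sD sM sQ] Kx x0; have s1 : s 1 = 1 by have := sQ 1; rewrite rmorph1.
have Kx' : x^-1 \in KK R n.
  rewrite inE -[x^-1]mul1r; apply: field_gen_div; last by rewrite inE in Kx.
  by have := mem_evalZ 1; rewrite inE evalZ1.
apply/eqP => sx; have := sM _ _ Kx Kx'; rewrite mulfV // s1 sx mul0r => /eqP.
by rewrite oner_eq0.
Qed.

Lemma field_hom_eq s s' : field_hom s -> field_hom s' -> s z = s' z ->
  {in KK R n, s =1 s'}.
Proof.
move=> hs hs' szE x Kx.
have /field_genP[f [g [g0 xE]]] : KK R n x by rewrite inE in Kx.
have Kg := mem_evalZ g.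
have xg : x * evalZ z g = evalZ z f by rewrite xE divfK.
apply: (mulIf (field_hom_neq0 hs Kg g0)).
case: (hs) (hs') => [_ sM _] [_ sM' _].
rewrite -sM // (field_hom_evalZ g hs) szE -(field_hom_evalZ g hs') -sM' //.
by rewrite xg !field_hom_evalZ // szE.
Qed.

End FieldHom.

(** [w i] are the conjugates of [zeta_n] under the chosen automorphisms, and
    [star_w] those which enter the star map. *)
Section Representatives.
Variables (R : realType) (n : nat) (sigma : 'I_(codim n).+1 -> R[i] -> R[i]).
Hypotheses (n_gt2 : (2 < n)%N) (repr : conj_representatives sigma).
Local Notation z := (zeta R n).
Let k := codim n.
Let w i := sigma i z.
Let star_w (j : 'I_k) := w (lift ord0 j).

Let n_gt0 : (0 < n)%N.
Proof. lia. Qed.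

Let hom i : field_hom n (sigma i).
Proof. by case: repr => _ sG _; exact: in_Gal_field_hom. Qed.

Let w_unity i : w i ^+ n = 1.
Proof.
rewrite -[w i](evalZX) -evalZ_exp -field_hom_evalZ //.
rewrite evalZ_exp evalZX zeta_expn //.
by have := field_hom_evalZ 1 (hom i); rewrite !evalZ1.
Qed.

Let w_root i f : evalZ (w i) f = 0 -> evalZ z f = 0.
Proof.
rewrite /w -field_hom_evalZ // => sf; apply/eqP; apply: contra_eqT sf => f0.
by apply: field_hom_neq0 => //; exact: mem_evalZ.
Qed.

Let root_w i f : evalZ z f = 0 -> evalZ (w i) f = 0.
Proof.
move=> f0; rewrite /w -field_hom_evalZ // f0.
by have := field_hom_evalZ 0 (hom i); rewrite !evalZ0.
Qed.

Let repr_uniq i j : {in KK R n, sigma j =1 sigma i} \/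
  {in KK R n, sigma j =1 conjc \o sigma i} -> i = j.
Proof.
case: repr => _ sG sU ij; have [i0 [_ uniq]] := sU _ (sG i).
by transitivity i0; [apply/esym/uniq; left | exact: uniq].
Qed.

Let w_inj : injective w.
Proof.
move=> i j wij; apply: repr_uniq; left.
by apply: field_hom_eq => //; exact: esym.
Qed.

(** For [i != j] because exactly one automorphism was chosen from each complex
    conjugate pair, for [i = j] because [w i] is conjugate to [zeta_n], which is
    not real. *)
Let w_conj i j : conjc (w i) != w j.
Proof.
apply/eqP => wij.
have ij : i = j.
  apply: repr_uniq; right; apply: field_hom_eq (esym wij) => //.
  exact: field_hom_conjc.
move: wij; rewrite -ij (conjc_unity n_gt0 (w_unity i)) => wV.
have wi0 := unity_neq0 n_gt0 (w_unity i).
have : evalZ z ('X ^+ 2 - 1) = 0.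
  apply: (@w_root i); rewrite evalZB evalZ_exp evalZX evalZ1.
  by rewrite expr2 -{1}wV mulVf // subrr.
rewrite evalZB evalZ_exp evalZX evalZ1 => /eqP.
rewrite subr_eq0 -(prim_order_dvd (zeta_prim R n_gt0)) => /dvdn_leq.
by move=> /(_ isT); lia.
Qed.

(** The numbers [w i] and their complex conjugates are [2 * k.+1] distinct roots
    of every integer polynomial that vanishes at [zeta_n]. *)
Let root_small f : evalZ z f = 0 -> (size f <= 2 * k.+1)%N -> f = 0.
Proof.
move=> fz fsize; apply/eqP; apply/negPn/negP => f0.
pose p : {poly R[i]} := map_poly intr f.
have p0 : p != 0 by rewrite map_poly_eq0_id0 // intr_eq0 lead_coef_eq0.
pose rs := [seq w i | i : 'I_k.+1] ++ [seq conjc (w i) | i : 'I_k.+1].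
have rs_roots : all (root p) rs.
  rewrite all_cat; apply/andP; split; apply/allP => _ /mapP[i _ ->]; apply/eqP.
    exact: root_w.
  by rewrite -[LHS]/(evalZ _ f) -(evalZ_rmorph conjc) /= root_w // rmorph0.
have rs_uniq : uniq rs.
  rewrite cat_uniq map_inj_uniq ?enum_uniq //=.
  rewrite (map_inj_uniq (inj_comp (can_inj (@conjcK R)) w_inj)) enum_uniq andbT.
  apply/hasPn => _ /mapP[i _ ->]; apply/negP => /mapP[j _ /eqP].
  exact/negP/w_conj.
have := max_poly_roots p0 rs_roots rs_uniq.
rewrite size_cat !size_image card_ord => /leq_trans/(_ (size_poly _ _)).
by move=> /leq_trans/(_ fsize); lia.
Qed.

(** There are [2 * k] real linear forms, the real and imaginary parts at the
    [star_w j], in [2 * k + 1] integer unknowns; one unknown more than forms is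
    enough for the box principle, and few enough for [root_small]. *)
Lemma small_conjugates eps : 0 < eps -> exists f : {poly int},
  evalZ z f != 0 /\ forall j, normc (evalZ (star_w j) f) < eps.
Proof.
move=> eps0; pose N := (2 * k).+1.
pose a (t : 'I_k * bool) (l : 'I_N) : R :=
  if t.2 then complex.Re (star_w t.1 ^+ l) else complex.Im (star_w t.1 ^+ l).
have card_t : (#|{: 'I_k * bool}| < N)%N.
  by rewrite card_prod card_ord card_bool mulnC.
have [x [[l xl] xa]] :=
  dirichlet_simultaneous a card_t (divr_gt0 eps0 (ltr0Sn R 1)).
pose f : {poly int} := \poly_(i < N) x (inord i).
have f0 : f != 0.
  apply: contra_neq xl => f0; have := coef_poly N (fun i => x (inord i)) l.
  by rewrite -/f f0 coef0 ltn_ord inord_val.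
exists f; split.
  apply: contra_neq f0 => /root_small; apply.
  by apply: leq_trans (size_poly _ _) _; rewrite /N; lia.
move=> j; have -> : evalZ (star_w j) f =
    Complex (\sum_i a (j, true) i * (x i)%:~R)
      (\sum_i a (j, false) i * (x i)%:~R).
  rewrite evalZ_poly; apply: complex_sum => l'; rewrite inord_val /a /=.
  rewrite -(rmorph_int (real_complex R)); case: (_ ^+ l') => c d.
  by apply/eqP; rewrite eq_complex /=; apply/andP; split; apply/eqP; ring.
apply: le_lt_trans (normc_le_ReIm _) _ => /=.
have := xa (j, true); have := xa (j, false); lra.
Qed.

(** Let [d] have small conjugates and let [P] be a real polynomial with
    [d * P = Y] under the star map, where [Y] is interior to [W].  Rounding [P] to
    an integer polynomial [g] and setting [c := d * g], the star image of
    [c + d * b i] differs from [Y] by that of [d * (P - g - b i)], where the second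
    factor is bounded independently of [d]. *)
Lemma window_fit m (b : 'I_m -> R[i]) W :
  window W -> (forall i, OO R n (b i)) ->
  exists c d : R[i], d != 0 /\
    forall i, OO R n (c + d * b i) /\ W (star sigma (c + d * b i)).
Proof.
move=> [[Y /nbhs_ballP[eps eps0 YW]] _ _ _] Ob.
have [fb fbE] := choice (fun i => (ring_genP z (b i)).1 (Ob i)).
pose B := \sum_i \sum_j normc (evalZ (star_w j) (fb i)).
have bB i j : normc (evalZ (star_w j) (fb i)) <= B.
  rewrite /B (bigD1 i) //= (bigD1 j) //= -addrA lerDl.
  rewrite addr_ge0 //; repeat (apply: sumr_ge0 => ? _) => //.
  - exact: normc_ge0.
  - exact: normc_ge0.
have B0 : 0 <= B by do 2 (apply: sumr_ge0 => ? _); exact: normc_ge0.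
(* [B] bounds the conjugates of the [b i], [2 * k] the rounding error *)
pose M := B + (2 * k)%:R + 1.
have M0 : 0 < M by rewrite ltr_wpDl // addr_ge0.
have [f [f0 fsmall]] := small_conjugates (divr_gt0 eps0 M0).
have fw0 j : evalZ (star_w j) f != 0.
  by apply: contra_neq f0; exact: w_root.
pose y j : R[i] := Complex (Y 0 j) (Y 1 j).
have [||P [Psize Py]] := @real_interpolation_family R _ star_w
   (fun j => y j / evalZ (star_w j) f).
- by move=> i j /w_inj/lift_inj.
- by move=> i j; exact: w_conj.
have [g gP] := poly_rounding P.
exists (evalZ z (f * g)), (evalZ z f); split=> // i.
rewrite fbE -evalZM -evalZD; split; first by apply/ring_genP; eexists.
apply: YW; split=> // r j; rewrite !mxE /ball /= /star.
rewrite field_hom_evalZ // -/(w _) -/(star_w j).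
set u := evalZ (star_w j) _.
have u_small : normc (y j - u) < eps.
  have -> : y j - u = evalZ (star_w j) f *
      ((evalR (star_w j) P - evalZ (star_w j) g) - evalZ (star_w j) (fb i)).
    by rewrite /u evalZD !evalZM Py; field.
  rewrite normcM; apply: le_lt_trans (_ : normc (evalZ (star_w j) f) * M < _).
    apply: ler_wpM2l; first exact: normc_ge0.
    apply: le_trans (le_normcD _ _) _; rewrite normcN.
    have := gP _ (normc_unity n_gt0 (w_unity (lift ord0 j))).
    have := bB i j; have : (size P)%:R <= (2 * k)%:R :> R.
      by rewrite ler_nat; rewrite card_ord in Psize.
    rewrite /M -/(star_w j); lra.
  by rewrite -ltr_pdivlMr.
have := le_lt_trans (Re_le_normc _) u_small.
have := le_lt_trans (Im_le_normc _) u_small.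
rewrite /y; case: (u) => u1 u2 /= hI hR.
case: r => -[|[|//]] r2 /=.
  by rewrite (_ : Ordinal r2 = 0) //; apply: val_inj.
by rewrite (_ : Ordinal r2 = 1) //; apply: val_inj.
Qed.

End Representatives.

(** * The equivalence *)

Lemma affinely_regular_similarity (R : realType) m (b : 'I_m -> R[i])
    (t : 'cV[R]_2) (c d : R[i]) : d != 0 ->
  affinely_regular (fun i => plane_of (b i)) ->
  affinely_regular (fun i => t + plane_of (c + d * b i)).
Proof.
move=> d0 breg; pose D := basis_mx d (d * Complex 0 1).
have -> : (fun i => t + plane_of (c + d * b i)) =
    (fun i => D *m plane_of (b i) + (t + plane_of c)).
  apply/funext => i; rewrite mul_basis_mx complex_mulE plane_ofD.
  by rewrite addrA addrC.
apply: affinely_regular_affine breg _.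
rewrite det_basis_mx; case: d d0 {D} => x y.
rewrite eq_complex /= negb_and => xy.
have -> : x * (x * 1 + y * 0) + - y * (x * 0 - y * 1) = x ^+ 2 + y ^+ 2 by ring.
by rewrite paddr_eq0 ?sqr_ge0 // !sqrf_eq0 negb_and.
Qed.

Theorem corollary7 (R : realType) (m n : nat) (hm : (3 <= m)%N) (hn : (3 <= n)%N)
    (L : set 'cV[R]_2) (hL : cyclotomic_model_sets n L) :
  [<-> (exists v : 'I_m -> 'cV[R]_2, affinely_regular v /\ polygon_in L v);
       kk R m `<=` kk R n;
       m \in [:: 3; 4; 6]%N \/ KK R m `<=` KK R n;
       [\/ m \in [:: 3; 4; 6]%N, (m %| n)%N
         | exists d : nat, [/\ m = (2 * d)%N, odd d & (d %| n)%N]];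
       m \in [:: 3; 4; 6]%N \/ OO R m `<=` OO R n;
       oo R m `<=` oo R n].
Proof.
have [m_gt0 n_gt0] : (0 < m)%N /\ (0 < n)%N by lia.
have [sigma [t [W [repr Wwin LE]]]] := hL.
have oo_m : oo R m (zeta_re R m) by exact: ring_gen_gen.
have kk_m : kk R m (zeta_re R m) by exact: ring_field_gen.
tfae.
- move=> [v [vreg [_ vL]]]; apply: field_gen_trans.
  have vz i : exists z, OO R n z /\ v i = t + plane_of z.
    by have := vL i; rewrite LE => -[z [Oz _] <-]; exists z.
  have [z zP] := choice vz.
  apply: KK_real => //; last exact: conjc_zeta_re.
  by apply: (affinely_regular_KK hm vreg (t := t) (z := z)) => i; case: (zP i).
- move=> kk_sub; have := kk_sub_KK n_gt0 (kk_sub _ kk_m).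
  move=> /(zeta_re_KK_divisibility hm hn)/(divisibility_OO R n_gt0)[|zO].
    by left.
  by right; apply: field_gen_trans; exact: ring_field_gen.
- case=> [|KK_sub]; first exact: Or31.
  by apply: zeta_re_KK_divisibility => //; apply: KK_sub; exact: kk_sub_KK.
- move=> /(divisibility_OO R n_gt0)[|zO]; first by left.
  by right; exact: ring_gen_trans.
- case=> [m346|OO_sub]; apply: ring_gen_trans.
    by have [c ->] := zeta_re_int R m346; exact: ring_gen_int.
  apply: OO_real => //; last exact: conjc_zeta_re.
  by apply: OO_sub; exact: oo_sub_OO.
- move=> oo_sub.
  have zK : KK R n (zeta_re R m).
    by apply: ring_field_gen; apply: oo_sub_OO => //; exact: oo_sub.
  have [b [Ob breg]] :=
    affinely_regular_in_OO hm hn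
      (divisibility_OO R n_gt0 (zeta_re_KK_divisibility hm hn zK)).
  have [c [d [d0 bW]]] := window_fit hn repr Wwin Ob.
  have vreg := affinely_regular_similarity t c d0 breg.
  exists (fun i => t + plane_of (c + d * b i)); split=> //.
  split; first exact: affinely_regular_convex.
  by move=> i; rewrite LE; exists (c + d * b i).
Qed.
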